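(* Let $N\ge1$ be an integer. For all $T>0$, $$\int_{\{\xi\in\mathbb{R}^N;\,|\xi|<1\}}P_\xi\left(\max_{0\le s\le T}|B_s|<1\right)d\xi\ \ge\ \frac{2\varpi_N}{j_{\frac{N-2}{2},1}^2}\exp\left(-\frac12\, j_{\frac{N-2}{2},1}^2\,T\right),$$ where $\varpi_N=\frac{2\pi^{N/2}}{\Gamma(N/2)}$ is the surface area of the $(N-1)$-dimensional unit sphere.
   Context: $(\{B_t\}_{t\ge0},\{P_x\}_{x\in\mathbb{R}^N})$ is an $N$-dimensional Brownian motion, with $B_0=x$ under $P_x$. For $\mu>-1$, $j_{\mu,1}$ denotes the first positive zero of the Bessel function $J_\mu$ of the first kind with index $\mu$. *)

(* Defs.v *)
From HB Require Import structures.
From mathcomp Require Import all_boot all_order all_algebra.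
From mathcomp Require Import all_classical all_reals all_analysis.
Set Implicit Arguments.
Unset Strict Implicit.
Unset Printing Implicit Defensive.
Import Order.TTheory GRing.Theory Num.Theory.
Import numFieldNormedType.Exports.
Local Open Scope classical_set_scope.
Local Open Scope ring_scope.

Section special_functions.
Context {R : realType}.
Implicit Types (s mu x j : R) (f : R -> R).

(* meaningful for s > 0 *)
Definition Gamma_fun s : R :=
  \int[@lebesgue_measure R]_(t in `]0, +oo[) (t `^ (s - 1) * expR (- t)).

(* meaningful for mu > -1 and x > 0 *)
Definition besselJ mu x : R :=
  limn (series (fun k : nat =>
    (-1) ^+ k / (k`!%:R * Gamma_fun (k%:R + mu + 1))
      * (x / 2) `^ (2 * k%:R + mu))).

Definition is_first_positive_zero f j :=
  [/\ 0 < j, f j = 0 & forall x, 0 < x -> x < j -> f x != 0].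

(* j_{mu,1}; the default value 0 would only be used if J_mu had no first
   positive zero, which does not happen for mu > -1 *)
Definition besselJ_zero1 mu : R := xget 0 (is_first_positive_zero (besselJ mu)).

(* surface area of the unit sphere of dimension N - 1 *)
Definition sphere_area (N : nat) : R :=
  2 * pi `^ (N%:R / 2) / Gamma_fun (N%:R / 2).

End special_functions.

Section euclidean_space.
Context {R : realType}.

Definition tuple_sub N (x y : N.-tuple R) : N.-tuple R :=
  [tuple tnth x i - tnth y i | i < N].

Definition enorm N (x : N.-tuple R) : R :=
  Num.sqrt (\sum_(i < N) tnth x i ^+ 2).

Definition open_unit_ball N : set (N.-tuple R) := [set x | enorm x < 1].

Definition cons_pair n (p : measurableTypeR R * n.-tuple R) : n.+1.-tuple R :=
  [the n.+1.-tuple R of p.1 :: p.2].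

Lemma measurable_cons_pair n : measurable_fun setT (@cons_pair n).
Proof. exact: (measurable_cons measurable_fst measurable_snd). Qed.

Section step.
Variables (n : nat) (m : {sigma_finite_measure set (n.-tuple R) -> \bar R}).

Definition lebesgue_tuple_step : set (n.+1.-tuple R) -> \bar R :=
  pushforward (@lebesgue_measure R \x m)%E (@cons_pair n).

Let measurable_preimage_cons A : measurable A ->
  measurable (@cons_pair n @^-1` A).
Proof.
by move=> mA; rewrite -[X in measurable X]setTI; exact: measurable_cons_pair.
Qed.

Let step0 : lebesgue_tuple_step set0 = 0%E.
Proof. by rewrite /lebesgue_tuple_step /pushforward preimage_set0 measure0. Qed.

Let step_ge0 A : (0 <= lebesgue_tuple_step A)%E.
Proof. by rewrite /lebesgue_tuple_step /pushforward measure_ge0. Qed.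

Let step_sigma_additive : semi_sigma_additive lebesgue_tuple_step.
Proof.
move=> F mF tF mUF; rewrite /lebesgue_tuple_step /pushforward preimage_bigcup.
apply: measure_semi_sigma_additive.
- by move=> k; exact: measurable_preimage_cons.
- apply/trivIsetP => /= i j _ _ ij; rewrite -preimage_setI.
  by move/trivIsetP : tF => /(_ _ _ _ _ ij) ->//; rewrite preimage_set0.
- by rewrite -preimage_bigcup; exact: measurable_preimage_cons.
Qed.

HB.instance Definition _ := isMeasure.Build _ _ _
  lebesgue_tuple_step step0 step_ge0 step_sigma_additive.

Let step_sigma_finite : sigma_finite setT lebesgue_tuple_step.
Proof.
have /sigma_finiteP[F [TF ndF Foo]] := sigma_finiteT (@lebesgue_measure R).
have /sigma_finiteP[G [TG ndG Goo]] := sigma_finiteT m.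
pose bh (x : n.+1.-tuple R) : n.-tuple R := [tuple of behead x].
pose C k : set (n.+1.-tuple R) := (@thead n R @^-1` F k) `&` (bh @^-1` G k).
have bhE x y : bh (cons_pair (x, y)) = y by exact/val_inj.
have CE k : @cons_pair n @^-1` C k = F k `*` G k.
  apply/seteqP; split=> -[x y] /=; rewrite /C /= theadE.
    by rewrite bhE.
  by rewrite bhE.
exists C.
  apply/esym/seteqP; split=> // x _.
  have [i _ Fi] : (\bigcup_k F k) (thead x) by rewrite -TF.
  have [j _ Gj] : (\bigcup_k G k) (bh x) by rewrite -TG.
  exists (maxn i j) => //; split=> /=.
    by move: (thead x) Fi; exact/subsetPset/ndF/leq_maxl.
  by move: (bh x) Gj; exact/subsetPset/ndG/leq_maxr.
move=> k; have [mF ltF] := Foo k; have [mG ltG] := Goo k; split.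
  apply: measurableI; rewrite -[X in measurable X]setTI.
    exact: (measurable_tnth ord0).
  exact: measurable_behead.
rewrite /lebesgue_tuple_step /pushforward CE.
by rewrite product_measure1E// lte_mul_pinfty// ge0_fin_numE.
Qed.

HB.instance Definition _ :=
  Measure_isSigmaFinite.Build _ _ _ lebesgue_tuple_step step_sigma_finite.

End step.

(* Lebesgue measure on R^n, as the n-fold product of Lebesgue measure on R *)
Fixpoint lebesgue_tuple n : {sigma_finite_measure set (n.-tuple R) -> \bar R} :=
  match n with
  | 0 => dirac ([tuple] : 0.-tuple R)
  | n'.+1 => lebesgue_tuple_step (lebesgue_tuple n')
  end.

End euclidean_space.
Arguments open_unit_ball {R} N.

Section brownian_motion.
Context {R : realType} {d : measure_display} {Om : measurableType d}.
Implicit Type P : probability Om R.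

(* the A i are arbitrary, possibly the full space, so that the product rule for
   the whole finite family contains the one for its subfamilies *)
Definition independent_family P d' (E : measurableType d') n
    (X : 'I_n -> Om -> E) : Prop :=
  forall A : 'I_n -> set E, (forall i, measurable (A i)) ->
    P (\bigcap_(i in setT) (X i @^-1` A i)) = (\prod_(i < n) P (X i @^-1` A i))%E.

(* X has distribution N(0, v I_N), for v > 0; the second argument of normal_prob
   is the standard deviation *)
Definition centered_gaussian P N (v : R) (X : Om -> N.-tuple R) : Prop :=
  independent_family P (fun i w => tnth (X w) i) /\
  forall (i : 'I_N) (A : set R), measurable A ->
    P ((fun w => tnth (X w) i) @^-1` A) = normal_prob 0 (Num.sqrt v) A.

Definition increment N (B : R -> Om -> N.-tuple R) (s t : R) : Om -> N.-tuple R :=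
  fun w => tuple_sub (B t w) (B s w).

(* (B, (P x)_x) is an N-dimensional Brownian motion; the process B is indexed by
   R but only its values at nonnegative times are constrained *)
Record is_brownian_motion N (B : R -> Om -> N.-tuple R)
    (P : N.-tuple R -> probability Om R) : Prop := {
  brownian_measurable : forall t, 0 <= t -> measurable_fun setT (B t) ;
  brownian_continuous : forall w i,
    {within `[0, +oo[, continuous (fun t => tnth (B t w) i)} ;
  brownian_start : forall x, P x [set w | B 0 w = x] = 1%E ;
  brownian_gaussian : forall x s t, 0 <= s -> s < t ->
    centered_gaussian (P x) (t - s) (increment B s t) ;
  brownian_independent : forall x n (t : nat -> R), 0 <= t 0%N ->
    (forall k, (k < n)%N -> t k <= t k.+1) ->
    independent_family (P x) (fun k : 'I_n => increment B (t k) (t k.+1)) }.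

(* for continuous paths and T >= 0 this supremum is the maximum over [0, T] *)
Definition running_max N (B : R -> Om -> N.-tuple R) (T : R) (w : Om) : R :=
  sup [set enorm (B s w) | s in `[0, T]].

End brownian_motion.

(* Main.v *)
From HB Require Import structures.
Require Import Defs.
From mathcomp Require Import all_boot all_order all_algebra.
From mathcomp Require Import all_classical all_reals all_analysis.
From mathcomp Require Import measurable_realfun.
From mathcomp Require Import ring lra.

(** Let [j] be the first positive zero of [J_mu], with [mu = (N - 2) / 2], let
    [D] be the closed ball [|x|^2 <= a] with [0 < a < 1], and let [phi] be the
    first Dirichlet eigenfunction of [D], which is radial and belongs to the
    eigenvalue [lam = j^2 / (2 a)] of [- Delta / 2]. The semigroup [Q_t] of
    Brownian motion killed outside [D] is symmetric on [L^2(D)], so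
    [<1, Q_T 1> = |Q_(T/2) 1|^2], and the Cauchy-Schwarz inequality gives

      [<1, Q_T 1> >= <1, Q_(T/2) phi>^2 / <phi, phi>
                  = exp(- lam T) <1, phi>^2 / <phi, phi>].

    Lommel's integrals evaluate the last quotient as
    [2 sphere_area a^(N/2) / j^2] ([integral_profile], [integral_profile_sqr]).
    The left side bounds the survival integral of the open unit ball from below,
    and the claim is the limit [a -> 1].

    The argument is run in discrete time. On a grid of step [h = c^2] the
    probability of lying in [D] at [n + 1] successive times is [K^n 1_D], where
    [K u (x) = 1_D(x) E u(x + c Z)] with [Z] a standard Gaussian vector
    ([brownian_survival]). The operator [K] is symmetric, because Lebesgue measure
    is invariant under translations and [Z] under change of sign
    ([killed_iter_symmetric]). The eigenvalue equation is replaced by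
    [K phi >= (1 - lam h) phi - O(h^(3/2))] on [D] ([gaussian_step]); over [T / h]
    steps the error is [O(h^(1/2))]. This inequality is where the cut-off at the
    boundary matters: [phi = f(|x|^2)] on [D] with [2 s f'' + N f' = - lam f], and
    [f] extended by [0] beyond its zero [a] still dominates its second-order Taylor
    polynomials up to a cubic error ([profile_taylor_positive_part]), so that only
    the moments of [Z] up to order two need exact values.

    Integrals of radial functions are computed from the volumes of balls
    ([layer_cake]), and the same formula, applied to the Gaussian integral, gives
    the volume of the unit ball ([unit_ball_vol_Gamma]). Finally, confinement in
    [D] at dyadic times decreases to confinement at all times ([confined_grid]),
    and the running maximum is below [1] exactly when the path is confined to one
    of the balls with [a < 1] ([running_max_lt1E]). *)

Set Implicit Arguments.
Unset Strict Implicit.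
Unset Printing Implicit Defensive.
Import Order.TTheory GRing.Theory Num.Theory.
Import numFieldNormedType.Exports.
Local Open Scope classical_set_scope.
Local Open Scope ring_scope.

(** * Product measures on tuples *)

(** The canonical measure structure of [pushforward] takes the measurability
    proof of the map as an argument; this bundles the two. *)
Definition image_measure d1 d2 (T1 : measurableType d1) (T2 : measurableType d2)
    (R : realType) (m : {measure set T1 -> \bar R}) (f : T1 -> T2)
    (mf : measurable_fun setT f) : {measure set T2 -> \bar R} :=
  measure_function_pushforward__canonical__measure_function_Measure m mf.

Lemma ge0_integral_image_measure d1 d2 (T1 : measurableType d1)
    (T2 : measurableType d2) (R : realType) (m : {measure set T1 -> \bar R})
    (f : T1 -> T2) (mf : measurable_fun setT f) (g : T2 -> \bar R) :
  measurable_fun setT g -> (forall y, 0 <= g y)%E ->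
  (\int[image_measure m mf]_y g y = \int[m]_x g (f x))%E.
Proof. by move=> mg g0; exact: (ge0_integral_pushforward mf). Qed.

Section rectangles.
Context d (T : measurableType d) (n : nat).

Definition rect (A : 'I_n -> set T) : set (n.-tuple T) :=
  [set t | forall i, A i (tnth t i)].

Lemma measurable_rect (A : 'I_n -> set T) :
  (forall i, measurable (A i)) -> measurable (rect A).
Proof.
move=> mA; have -> : rect A = \bigcap_(i in setT) ((tnth (T:=T))^~ i @^-1` A i).
  by apply/seteqP; split => t /= H; [move=> i _; exact: H|move=> i; exact: H].
apply: fin_bigcap_measurable => // i _.
by rewrite -[X in measurable X]setTI; exact: (measurable_tnth i).
Qed.

Let rects : set (set (n.-tuple T)) :=
  [set rect A | A in [set A | forall i, measurable (A i)]].

Let measurable_rectsE : @measurable _ (n.-tuple T) = <<s rects >>.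
Proof.
apply/seteqP; split; last first.
  apply: smallest_sub; first exact: sigma_algebra_measurable.
  by move=> _ [A mA <-]; exact: measurable_rect.
apply: smallest_sub; first exact: smallest_sigma_algebra.
move=> B; rewrite -bigcup_seq => -[i /= _ [C mC <-]].
apply: sub_sigma_algebra.
exists (fun k => if k == i then C else setT) => /=.
  by move=> k; case: ifP.
rewrite setTI; apply/seteqP; split => t /=.
  by move=> /(_ i); rewrite eqxx.
by move=> Ct k; case: eqP => // ->.
Qed.

(** Rectangles form a pi-system that generates the product sigma-algebra. *)
Lemma tuple_measure_unique (R : realType)
    (m1 m2 : {measure set (n.-tuple T) -> \bar R}) :
  (m1 setT < +oo)%E ->
  (forall A, (forall i, measurable (A i)) -> m1 (rect A) = m2 (rect A)) ->
  forall A, measurable A -> m1 A = m2 A.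
Proof.
move=> m1oo m12 A mA.
have rectT : rect (fun=> setT) = setT by apply/seteqP; split.
apply: (measure_unique rects (fun=> setT)) => //.
- move=> _ _ [B mB <-] [C mC <-]; exists (fun i => B i `&` C i).
    by move=> i; exact: measurableI.
  by apply/seteqP; split=> t /=; [move=> H; split=> i; case: (H i)
    |move=> [H1 H2] i; split].
- by move=> _; exists (fun=> setT).
- by rewrite bigcup_const//; exists 0%N.
- by move=> _ [B mB <-]; exact: m12.
Qed.

End rectangles.

Section lebesgue_affine.
Context {R : realType}.
Local Notation mu := (@lebesgue_measure R).

(** Scaled translation: one Gaussian step of the walk, and, with the tuple
    in the other argument, the affine changes of variable of the space. *)
Definition tcomb N (c : R) (z x : N.-tuple R) : N.-tuple R :=
  [tuple c * tnth z i + tnth x i | i < N].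

Lemma measurable_tcomb N d (T : measurableType d) c (f g : T -> N.-tuple R) :
  measurable_fun setT f -> measurable_fun setT g ->
  measurable_fun setT (fun w => tcomb c (f w) (g w)).
Proof.
move=> mf mg; apply/measurable_fun_tnthP => i /=.
rewrite (_ : _ \o _ = (fun w => c * tnth (f w) i + tnth (g w) i)); last first.
  by apply/funext => w /=; rewrite tnth_mktuple.
apply: measurable_funD.
  apply: measurable_funM => //.
  exact: (measurableT_comp (measurable_tnth i) mf).
exact: (measurableT_comp (measurable_tnth i) mg).
Qed.

(** It is enough to compare both sides on half-open intervals. *)
Lemma lebesgue_measure_affine (c b : R) (A : set R) : 0 < c -> measurable A ->
  mu A = (c%:E * mu ((fun x => (c * x + b)%R) @^-1` A))%E.
Proof.
move=> c0 mA.
have mf : measurable_fun setT (fun x : measurableTypeR R => (c * x + b)%R : measurableTypeR R).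
  by apply: measurable_funD => //; exact: measurable_funM.
pose m := mscale (NngNum (ltW c0)) (image_measure mu mf).
have -> : (c%:E * mu ((fun x => (c * x + b)%R) @^-1` A))%E = m A by [].
apply: (@lebesgue_measure_unique R m) => // _ [[x y] _ <-].
rewrite /m /mscale /=.
change (mu `]x, y] = c%:E * mu ((fun u : R => (c * u + b)%R) @^-1` `]x, y]))%E.
have -> : (fun x0 : R => c * x0 + b) @^-1` `]x, y] = `](x - b) / c, (y - b) / c]%classic.
  apply/seteqP; split => u /=; rewrite !in_itv/= ltr_pdivrMr// ler_pdivlMr// => /andP[h1 h2];
    apply/andP; split; lra.
rewrite !lebesgue_measure_itv/= !lte_fin ltr_pM2r ?invr_gt0// ltrD2r.
case: ifPn => // xy; last by rewrite mule0.
by rewrite -!EFinB -EFinM; congr EFin; field; lra.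
Qed.

Lemma ge0_integral_affine (c b : R) (f : R -> \bar R) : 0 < c ->
  measurable_fun setT f -> (forall x, 0 <= f x)%E ->
  (\int[mu]_x f x = c%:E * \int[mu]_x f (c * x + b)%R)%E.
Proof.
move=> c0 mf f0.
have mg : measurable_fun setT (fun x : measurableTypeR R => (c * x + b)%R : measurableTypeR R).
  by apply: measurable_funD => //; exact: measurable_funM.
pose m := mscale (NngNum (ltW c0)) (image_measure mu mg).
transitivity (\int[m]_x f x)%E.
  apply: eq_measure_integral => A mA _.
  exact: (lebesgue_measure_affine b c0).
rewrite /m ge0_integral_mscale//= ge0_integral_image_measure//.
Qed.

Lemma integral_lebesgue_tupleS N (f : N.+1.-tuple R -> \bar R) :
  measurable_fun setT f -> (forall x, 0 <= f x)%E ->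
  (\int[lebesgue_tuple N.+1]_x f x =
   \int[mu]_x \int[lebesgue_tuple N]_y f (cons_pair (x, y)))%E.
Proof.
move=> mf f0.
transitivity (\int[(mu \x lebesgue_tuple N)]_z f (cons_pair z))%E.
  exact: (ge0_integral_pushforward (@measurable_cons_pair R N)).
rewrite (fubini_tonelli1 (f \o @cons_pair R N))//; last by move=> z; exact: f0.
by apply: measurableT_comp => //; exact: measurable_cons_pair.
Qed.

Lemma tcomb_cons_pair N c (x b0 : R) (y b : N.-tuple R) :
  tcomb c (cons_pair (x, y)) (cons_pair (b0, b)) =
  cons_pair (c * x + b0, tcomb c y b).
Proof.
apply: eq_from_tnth => i; rewrite tnth_mktuple.
case: (unliftP ord0 i) => [k ->|->].
  by rewrite !tnthS tnth_mktuple.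
by rewrite !tnth0.
Qed.

(** Coordinate by coordinate, from the one-dimensional case. Used for
    translations ([c = 1]) and for dilations ([b = 0]). *)
Lemma ge0_integral_lebesgue_tuple_affine N (c : R) (b : N.-tuple R)
    (f : N.-tuple R -> \bar R) : 0 < c ->
  measurable_fun setT f -> (forall x, 0 <= f x)%E ->
  (\int[lebesgue_tuple N]_x f x =
   (c ^+ N)%:E * \int[lebesgue_tuple N]_x f (tcomb c x b))%E.
Proof.
move=> c0; elim: N b f => [|N IH] b f mf f0.
  rewrite expr0 mul1e; apply: eq_integral => x _; congr f.
  by rewrite [LHS]tuple0 [RHS]tuple0.
rewrite integral_lebesgue_tupleS// integral_lebesgue_tupleS//; last first.
  by apply: measurableT_comp => //; exact: measurable_tcomb.
set b' : N.-tuple R := [tuple of behead b].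
have bE : b = cons_pair (thead b, b').
  by rewrite /cons_pair/= {1}(tuple_eta b).
pose g x := (\int[lebesgue_tuple N]_y f (cons_pair (x, y)))%E.
have mfc : measurable_fun setT (f \o @cons_pair R N).
  by apply: measurableT_comp => //; exact: measurable_cons_pair.
have mg : measurable_fun setT g.
  exact: (measurable_fun_fubini_tonelli_F _ mfc (fun z => f0 _)).
have g0 x : (0 <= g x)%E by apply: integral_ge0.
have mf1 x : measurable_fun setT (fun y : N.-tuple R => f (cons_pair (x, y))).
  apply: measurableT_comp => //.
  exact: (measurableT_comp (@measurable_cons_pair R N) (pair1_measurable x)).
rewrite (@ge0_integral_affine c (thead b) g c0 mg g0).
rewrite exprS EFinM -muleA; congr (_ * _)%E.
rewrite -ge0_integralZl//; last 3 first.
- apply: (measurable_fun_fubini_tonelli_F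
    (fun z : measurableTypeR R * N.-tuple R => f (tcomb c (cons_pair z) b))) => //.
  apply: measurableT_comp => //; apply: measurable_tcomb => //.
  exact: measurable_cons_pair.
- by move=> x _; exact: integral_ge0.
- by rewrite lee_fin exprn_ge0// ltW.
apply: eq_integral => x _.
rewrite /g (IH b')//; congr (_ * _)%E; apply: eq_integral => y _.
by rewrite -tcomb_cons_pair -bE.
Qed.

End lebesgue_affine.

(** * One-variable calculus *)

Section calculus.
Context {R : realType}.
Local Notation mu := (@lebesgue_measure R).

Lemma is_derive_cvg (f : R -> R) (x d : R) :
  is_derive x 1 f d -> f y @[y --> x] --> f x.
Proof.
by move=> [df _]; apply: differentiable_continuous; exact/derivable1_diffP.
Qed.

(** The integrand may blow up at [0], as [t `^ (s - 1)] does for [s < 1], so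
    the fundamental theorem of calculus is applied on [[b / k.+2, b]]. *)
Lemma ge0_integral_derive_at0 (f F : R -> R) (b l : R) : 0 < b ->
  (forall x : R, 0 < x -> is_derive x 1 F (f x)) ->
  (forall x : R, 0 < x -> {for x, continuous f}) ->
  (forall x : R, 0 < x -> x <= b -> 0 <= f x) ->
  F x @[x --> 0^'+] --> l ->
  (\int[mu]_(x in `]0%R, b]) (f x)%:E = (F b - l)%:E)%E.
Proof.
move=> b0 dF cf f0 Fl.
pose S k : set R := `[b / k.+2%:R, b]%classic.
have US : \bigcup_k S k = `]0, b]%classic.
  apply/seteqP; split => x /=.
    move=> [k _]; rewrite /S/= !in_itv/= => /andP[h1 ->]; rewrite andbT.
    by rewrite (lt_le_trans _ h1)// divr_gt0.
  rewrite in_itv/= => /andP[x0 xb].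
  exists (Num.truncn (b / x)) => //; rewrite /S/= in_itv/= xb andbT.
  rewrite ler_pdivrMr// mulrC -ler_pdivrMr//.
  have := truncnS_gt (b / x) => /ltW/le_trans; apply.
  by rewrite ler_nat.
have mf (i : nat) : measurable_fun (S i) f.
  apply: (@measurable_funS _ _ (measurableTypeR R) (measurableTypeR R) `]0, +oo[%classic) => //.
    move=> x /=; rewrite /S/= !in_itv/= andbT => /andP[h _].
    by rewrite (lt_le_trans _ h)// divr_gt0.
  apply: open_continuous_measurable_fun; first exact: interval_open.
  by move=> x; rewrite inE/= in_itv/= andbT; exact: cf.
rewrite -US.
have h : (\int[mu]_(x in S i) (EFin \o f) x)%E @[i --> \oo] -->
    (\int[mu]_(x in \bigcup_i S i) (EFin \o f) x)%E.
  apply: (@ge0_nondecreasing_set_cvg_integral _ (measurableTypeR R)) => //.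
- apply/nondecreasing_seqP => k; rewrite subsetEset => x /=.
  rewrite /S/= !in_itv/= => /andP[h1 ->]; rewrite andbT.
  rewrite (le_trans _ h1)// ler_pM2l// lef_pV2// ?posrE//.
  by rewrite ler_nat.
- by move=> i; exact: measurable_itv.
- by move=> i; apply/measurable_EFinP; exact: mf.
- move=> i x /=; rewrite /S/= in_itv/= lee_fin => /andP[h1 h2].
  by apply: f0 => //; rewrite (lt_le_trans _ h1)// divr_gt0.
apply: cvg_unique h _ => //.
have -> : (fun i => \int[mu]_(x in S i) (EFin \o f) x)%E =
    EFin \o (fun i : nat => F b - F (b / i.+2%:R)).
  apply/funext => i /=; rewrite EFinB.
  have bi0 : 0 < b / i.+2%:R by rewrite divr_gt0.
  have bib : b / i.+2%:R < b.
    by rewrite ltr_pdivrMr// ltr_pMr// ltr1n.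
  apply: continuous_FTC2 => //.
  - apply: continuous_in_subspaceT => x; rewrite inE/= in_itv/= => /andP[h1 _].
    by apply: cf; exact: lt_le_trans h1.
  - split.
    + move=> x; rewrite in_itv/= => /andP[h1 _].
      by have /dF[] : 0 < x by exact: lt_trans h1.
    + apply: cvg_at_right_filter; exact: is_derive_cvg (dF _ bi0).
    + apply: cvg_at_left_filter; exact: is_derive_cvg (dF _ b0).
  - move=> x; rewrite in_itv/= => /andP[h1 _].
    have x0 : 0 < x by exact: lt_trans h1.
    by rewrite derive1E; have [_ ->] := dF _ x0.
apply: cvg_EFin; first exact: nearW.
apply: cvgB; first exact: cvg_cst.
move/cvg_at_rightP : Fl; apply; split; first by move=> k; rewrite divr_gt0.
rewrite -[X in _ --> X](mulr0 b); apply: cvgM; first exact: cvg_cst.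
have := @cvg_harmonic R; rewrite -cvg_shiftS; exact.
Qed.

Lemma integral_expRN_oy (a : R) :
  (\int[mu]_(x in `]a, +oo[) (expR (- x))%:E = (expR (- a))%:E)%E.
Proof.
rewrite integral_itv_obnd_cbnd; last first.
  by apply: measurable_funTS; apply/measurable_EFinP; exact: measurableT_comp.
have dE (x : R) : is_derive x 1 (fun x : R => - expR (- x)) (expR (- x)).
  by apply: is_derive_eq; rewrite mulrN1 opprK.
rewrite (@ge0_continuous_FTC2y R (fun x => expR (- x)) (fun x => - expR (- x)) a 0)//=.
- by rewrite -EFinB sub0r opprK.
- apply: continuous_subspaceT => x; apply: continuous_comp.
    exact: continuousN.
  exact: continuous_expR.
- by rewrite -oppr0; apply: cvgN; exact: cvgr_expR.
- apply: cvg_at_right_filter; exact: is_derive_cvg (dE a).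
- by move=> x _; rewrite derive1E; have [_ ->] := dE x.
Qed.

Lemma measurable_ltr_set d (X : measurableType d) (f g : X -> R) :
  measurable_fun setT f -> measurable_fun setT g ->
  measurable [set x | f x < g x].
Proof.
move=> mf mg; have := measurable_fun_ltr mf mg measurableT (Y := [set true]) Logic.I.
by rewrite setTI; congr measurable; apply/seteqP; split => x /=.
Qed.

Lemma measurable_ler_set d (X : measurableType d) (f g : X -> R) :
  measurable_fun setT f -> measurable_fun setT g ->
  measurable [set x | f x <= g x].
Proof.
move=> mf mg; have := measurable_fun_ler mf mg measurableT (Y := [set true]) Logic.I.
by rewrite setTI; congr measurable; apply/seteqP; split => x /=.
Qed.

(** Both sides integrate [f x * g t] over the region [p x < t]. Depending on
    the choice of [p], [f] and [g] this is the layer-cake formula or an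
    integration by parts. *)
Lemma tonelli_level d (X : measurableType d)
    (m : {sigma_finite_measure set X -> \bar R}) (p : X -> R)
    (f : X -> \bar R) (g : R -> \bar R) :
  measurable_fun setT p -> measurable_fun setT f -> measurable_fun setT g ->
  (forall x, 0 <= f x)%E -> (forall t, 0 <= g t)%E ->
  (\int[m]_x (f x * \int[mu]_(t in `]p x, +oo[) g t) =
   \int[mu]_t (g t * \int[m]_(x in [set x | (p x < t)%R]) f x))%E.
Proof.
move=> mp mf mg f0 g0.
pose A : set (X * measurableTypeR R) := [set z | p z.1 < z.2].
have mA : measurable A.
  by apply: measurable_ltr_set => //; exact: measurableT_comp.
pose F (z : X * measurableTypeR R) := (f z.1 * g z.2 * (\1_A z)%:E)%E.
have mF : measurable_fun setT F.
  apply: emeasurable_funM.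
    apply: emeasurable_funM; exact: measurableT_comp.
  by apply/measurable_EFinP; exact: measurable_indic.
have F0 z : (0 <= F z)%E by rewrite !mule_ge0// lee_fin.
have := fubini_tonelli (m1 := m) (m2 := mu) F mF F0; rewrite /F.
have -> : (\int[m]_x \int[mu]_y (f x * g y * (\1_A (x, y))%:E) =
    \int[m]_x (f x * \int[mu]_(t in `]p x, +oo[) g t))%E.
  apply: eq_integral => x _.
  rewrite [in RHS]integral_mkcond -ge0_integralZl//; last 2 first.
  - by apply/(measurable_restrictT _ _).1 => //; exact: measurable_funTS.
  - by move=> t _; apply: erestrict_ge0.
  apply: eq_integral => t _; rewrite -muleA; congr (_ * _)%E.
  rewrite patchE indicE; case: ifPn => [|/negP].
    by rewrite inE/= in_itv/= andbT => h; rewrite mem_set//= mule1.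
  by rewrite inE/= in_itv/= andbT => h; rewrite memNset//= mule0.
move=> ->; apply: eq_integral => t _.
have mpt : measurable [set x | p x < t].
  exact: measurable_ltr_set.
rewrite [in RHS]integral_mkcond -ge0_integralZl//; last 2 first.
- by apply/(measurable_restrictT _ _).1 => //; exact: measurable_funTS.
- by move=> x _; apply: erestrict_ge0.
apply: eq_integral => x _; rewrite muleAC muleC; congr (_ * _)%E.
rewrite patchE indicE; case: ifPn => [|/negP].
  by rewrite inE/= => h; rewrite mem_set//= mule1.
by rewrite inE/= => h; rewrite memNset//= mule0.
Qed.

End calculus.

(** * The Gamma function *)

Lemma integral_indicT d (T : measurableType d) (R : realType)
    (m : {measure set T -> \bar R}) (A : set T) : measurable A ->
  (\int[m]_x (\1_A x)%:E = m A)%E.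
Proof. by move=> mA; rewrite integral_indic// setIT. Qed.

Section gamma.
Context {R : realType}.
Local Notation mu := (@lebesgue_measure R).

Let gamma_int (s : R) : \bar R :=
  (\int[mu]_(t in `]0%R, +oo[) (t `^ (s - 1) * expR (- t))%:E)%E.

Lemma integral_powR (s t : R) : 0 < s -> 0 < t ->
  (\int[mu]_(u in `]0%R, t]) (s * u `^ (s - 1))%:E = (t `^ s)%:E)%E.
Proof.
move=> s0 t0.
rewrite (@ge0_integral_derive_at0 R _ (fun x => x `^ s) t 0)//.
- by rewrite subr0.
- move=> x x0; apply: is_derive_cvg; apply: is_deriveM.
  exact: is_derive1_powR.
- by move=> x x0 _; rewrite mulr_ge0// ?powR_ge0// ltW.
- exact: powR_cvg0.
Qed.

(** [expR (- u)] is the integral of [expR (- t)] over [t > u], and [t `^ s] is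
    the integral of [s * u `^ (s - 1)] over [u < t]: exchange the integrals.
    No finiteness is needed: [fine] maps [+oo] to [0] on both sides. *)
Lemma Gamma_funS (s : R) : 0 < s -> Gamma_fun (s + 1) = s * Gamma_fun s.
Proof.
move=> s0; rewrite /Gamma_fun /Rintegral.
rewrite -/(gamma_int s) -/(gamma_int (s + 1)).
suff -> : gamma_int (s + 1) = (s%:E * gamma_int s)%E.
  case: (gamma_int s) => [r||]//=.
    by rewrite gt0_muley ?lte_fin//= mulr0.
  by rewrite gt0_muleNy ?lte_fin//= mulr0.
pose f (u : R) : \bar R := ((fun u => (s * u `^ (s - 1))%:E) \_ `]0%R, +oo[) u.
have mpow (r : R) : measurable_fun setT (fun u : R => (u `^ r)).
  exact: measurable_powR.
have mexp : measurable_fun setT (fun t : R => expR (- t)).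
  exact: measurableT_comp.
have mf : measurable_fun setT f.
  apply/(measurable_restrictT _ _).1 => //; apply/measurable_EFinP.
  by apply: measurable_funTS; exact: measurable_funM.
have f0 t : (0 <= f t)%E.
  apply: erestrict_ge0 => u; rewrite lee_fin => _.
  by rewrite mulr_ge0 ?powR_ge0// ltW.
have := tonelli_level mu (p := id) (f := f)
  (g := fun t => (expR (- t))%:E) (@measurable_id _ _ _) mf _ f0 _.
have mexp' : measurable_fun setT (fun t : R => (expR (- t))%:E) by exact/measurable_EFinP.
move=> /(_ mexp' (fun t => expR_ge0 _)) H.
rewrite /gamma_int -ge0_integralZl//; last 3 first.
- apply/measurable_EFinP; apply: measurable_funTS; exact: measurable_funM.
- by move=> t _; rewrite lee_fin mulr_ge0 ?powR_ge0 ?expR_ge0.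
- by rewrite lee_fin ltW.
transitivity (\int[mu]_t ((expR (- t))%:E * \int[mu]_(x in [set x | (x < t)%R]) f x))%E; last first.
  rewrite -H [RHS]integral_mkcond; apply: eq_integral => u _.
  rewrite integral_expRN_oy /f !patchE; case: ifPn => _; last by rewrite mul0e.
  by rewrite -!EFinM mulrA.
rewrite integral_mkcond; apply: eq_integral => t _.
rewrite patchE addrK; case: ifPn => [|/negP].
  rewrite inE/= in_itv/= andbT => t0; rewrite EFinM muleC; congr (_ * _)%E.
  rewrite -integral_powR// -integral_itv_bndo_bndc; last first.
    by apply: measurable_funTS; apply/measurable_EFinP; exact: measurable_funM.
  rewrite /f -integral_mkcondr; congr (integral _ _ _).
  apply/seteqP; split => x /=; rewrite !in_itv/= ?andbT.
    by move=> /andP[].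
  by move=> [-> ->].
rewrite inE/= in_itv/= andbT => /negP; rewrite -leNgt => t0.
rewrite integral0_eq ?mule0// => x /= xt; rewrite /f patchE memNset//=.
by rewrite in_itv/= andbT; apply/negP; rewrite -leNgt; exact: ltW (lt_le_trans xt t0).
Qed.

End gamma.

(** * Volumes of balls and radial integrals *)

Section euclid.
Context {R : realType}.
Local Notation mu := (@lebesgue_measure R).

Definition sqn N (x : N.-tuple R) : R := \sum_(i < N) tnth x i ^+ 2.

Lemma sqn_ge0 N (x : N.-tuple R) : 0 <= sqn x.
Proof. by apply: sumr_ge0 => i _; exact: sqr_ge0. Qed.

Lemma measurable_sqn N : measurable_fun setT (@sqn N).
Proof.
apply: measurable_sum => i; apply: measurable_funX; exact: measurable_tnth.
Qed.

Lemma sqn_cons_pair N (x : R) (y : N.-tuple R) :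
  sqn (cons_pair (x, y)) = x ^+ 2 + sqn y.
Proof.
rewrite /sqn big_ord_recl tnth0; congr (_ + _).
by apply: eq_bigr => i _; rewrite tnthS.
Qed.

Lemma integral_gauss_tuple N :
  (\int[lebesgue_tuple N]_x (expR (- sqn x))%:E = (Num.sqrt pi ^+ N)%:E :> \bar R)%E.
Proof.
have mG n : measurable_fun setT (fun x : n.-tuple R => (expR (- sqn x))%:E).
  apply/measurable_EFinP; apply: measurableT_comp => //.
  by apply: measurableT_comp => //; exact: measurable_sqn.
elim: N => [|N IH].
  rewrite /= integral_dirac// ?diracT ?mul1e.
    by rewrite /sqn big_ord0 oppr0 expR0 expr0.
  exact: mG.
rewrite (integral_lebesgue_tupleS (mG N.+1) (fun x => expR_ge0 _)).
transitivity (\int[mu]_x ((gauss_fun x)%:E * (Num.sqrt pi ^+ N)%:E))%E.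
  apply: eq_integral => x _; rewrite -IH -ge0_integralZl//; last 2 first.
  - exact: mG.
  - by rewrite lee_fin gauss_fun_ge0.
  by apply: eq_integral => y _; rewrite sqn_cons_pair opprD expRD.
rewrite ge0_integralZr//; last 2 first.
- by apply/measurable_EFinP; exact: measurable_gauss_fun.
- by move=> x _; rewrite lee_fin gauss_fun_ge0.
by rewrite integralT_gauss -EFinM exprS.
Qed.

Definition unit_ball_vol N : \bar R :=
  lebesgue_tuple N [set x : N.-tuple R | sqn x < 1].

Definition tzero N : N.-tuple R := [tuple 0 | i < N].

Lemma sqn_scale N c (x : N.-tuple R) : sqn (tcomb c x (tzero N)) = c ^+ 2 * sqn x.
Proof.
rewrite /sqn mulr_sumr; apply: eq_bigr => i _.
by rewrite !tnth_mktuple addr0 exprMn.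
Qed.

Lemma measurable_sqn_lt N (t : R) : measurable [set x : N.-tuple R | sqn x < t].
Proof. by apply: measurable_ltr_set => //; exact: measurable_sqn. Qed.

(** A dilation by [Num.sqrt t]. *)
Lemma lebesgue_tuple_ball N (t : R) : 0 < t ->
  (lebesgue_tuple N [set x : N.-tuple R | (sqn x < t)%R] =
   (t `^ (N%:R / 2))%:E * unit_ball_vol N)%E.
Proof.
move=> t0; have st0 : 0 < Num.sqrt t by rewrite sqrtr_gt0.
rewrite -integral_indicT; last exact: measurable_sqn_lt.
rewrite (@ge0_integral_lebesgue_tuple_affine _ _ (Num.sqrt t) (tzero N))//; last first.
  by apply/measurable_EFinP; apply: measurable_indic; exact: measurable_sqn_lt.
rewrite powRrM powRAC powR12_sqrt ?ltW// powR_mulrn ?sqrtr_ge0//.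
congr (_ * _)%E; rewrite /unit_ball_vol -integral_indicT; last first.
  exact: measurable_sqn_lt.
apply: eq_integral => x _; rewrite !indicE; congr (_%:R)%:E; congr nat_of_bool.
apply/idP/idP; rewrite !inE/= sqn_scale sqr_sqrtr ?ltW//.
  by rewrite -ltr_pdivlMl// mulVf// gt_eqF.
by move=> h; rewrite -ltr_pdivlMl// mulVf// gt_eqF.
Qed.

(** Integration of radial functions without polar coordinates: a function of
    [sqn x] given as a tail integral of [q] only needs the volumes of balls. *)
Lemma layer_cake N (q : R -> \bar R) :
  measurable_fun setT q -> (forall t, 0 <= q t)%E ->
  (\int[lebesgue_tuple N]_x \int[mu]_(t in `]sqn x, +oo[) q t =
   unit_ball_vol N * \int[mu]_(t in `]0%R, +oo[) (q t * (t `^ (N%:R / 2))%:E))%E.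
Proof.
move=> mq q0.
have := tonelli_level (lebesgue_tuple N) (f := fun=> 1%E)
  (@measurable_sqn N) _ mq _ q0.
move=> /(_ (measurable_cst _)).
under eq_integral do rewrite mul1e.
move=> ->; last by move=> _; exact: lee01.
rewrite -ge0_integralZl//; last 2 first.
- apply: measurable_funTS; apply: emeasurable_funM => //.
  by apply/measurable_EFinP; exact: measurable_powR.
- by move=> t _; rewrite mule_ge0// lee_fin powR_ge0.
rewrite [RHS]integral_mkcond; apply: eq_integral => t _.
rewrite integral_cst ?mul1e; last exact: measurable_sqn_lt.
rewrite patchE; case: ifPn => [|/negP].
  rewrite inE/= in_itv/= andbT => t0; rewrite lebesgue_tuple_ball//.
  by rewrite muleA muleC.
rewrite inE/= in_itv/= andbT => /negP; rewrite -leNgt => t0.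
rewrite (_ : [set _ | _] = set0) ?measure0 ?mule0//.
apply/seteqP; split => x //=; apply/negP; rewrite -leNgt.
exact: le_trans t0 (sqn_ge0 x).
Qed.

(** For [q t = expR (- t)] the layer-cake formula evaluates the Gaussian
    integral as the volume of the unit ball times a Gamma integral. *)
Lemma unit_ball_vol_Gamma N :
  exists2 V : R, unit_ball_vol N = V%:E &
    0 < V /\ V * Gamma_fun (N%:R / 2 + 1) = pi `^ (N%:R / 2).
Proof.
have := layer_cake N (q := fun t => (expR (- t))%:E) _ (fun t => expR_ge0 _).
have mexp' : measurable_fun setT (fun t : R => (expR (- t))%:E).
  by apply/measurable_EFinP; exact: measurableT_comp.
move=> /(_ mexp').
under eq_integral do rewrite integral_expRN_oy.
rewrite integral_gauss_tuple.
under [in RHS]eq_integral do rewrite -EFinM mulrC.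
rewrite powRrM powRAC powR12_sqrt ?pi_ge0// powR_mulrn ?sqrtr_ge0//.
rewrite /Gamma_fun addrK /Rintegral.
have p0 : 0 < Num.sqrt (pi : R) ^+ N by rewrite exprn_gt0// sqrtr_gt0 pi_gt0.
have V0 : (0 <= unit_ball_vol N)%E by exact: measure_ge0.
set I := (X in (_ * X)%E); rewrite -[X in fine X]/I.
have I0 : (0 <= I)%E.
  by apply: integral_ge0 => t _; rewrite lee_fin mulr_ge0 ?powR_ge0 ?expR_ge0.
(* a product that is finite and nonzero has two finite factors *)
case: (unit_ball_vol N) V0 => [V||]// V0.
- have [->|Vn0] := eqVneq V 0.
    by rewrite mul0e => -[e]; rewrite e ltxx in p0.
  have {Vn0}V0 : 0 < V by rewrite lt0r Vn0.
  case: I I0 => [I||]// I0.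
  + by rewrite -EFinM => -[->]; exists V.
  + by rewrite gt0_muley.
- have [->|In0] := eqVneq I 0%E.
    by rewrite mule0 => -[e]; rewrite e ltxx in p0.
  by rewrite gt0_mulye// lt0e In0.
Qed.

Lemma Gamma_fun_ge0 (s : R) : 0 <= Gamma_fun s.
Proof.
rewrite /Gamma_fun /Rintegral fine_ge0//; apply: integral_ge0 => t _.
by rewrite lee_fin mulr_ge0 ?powR_ge0 ?expR_ge0.
Qed.

Lemma Gamma_fun_half_gt0 N : (0 < N)%N -> 0 < Gamma_fun (N%:R / 2 : R).
Proof.
move=> N0; have [V _ [V0 h]] := unit_ball_vol_Gamma N.
rewrite lt0r Gamma_fun_ge0 andbT; apply/eqP => e.
have : 0 < pi `^ (N%:R / 2) :> R by rewrite powR_gt0 ?pi_gt0.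
by rewrite -h Gamma_funS ?divr_gt0 ?ltr0n// e !mulr0 ltxx.
Qed.

Lemma unit_ball_vol_sphere_area N : (0 < N)%N ->
  unit_ball_vol N = (sphere_area N / N%:R)%:E.
Proof.
move=> N0; have [V -> [V0]] := unit_ball_vol_Gamma N.
rewrite Gamma_funS ?divr_gt0 ?ltr0n// => h; congr EFin.
have G0 : 0 < Gamma_fun (N%:R / 2 : R) by exact: Gamma_fun_half_gt0.
have n0 : 0 < N%:R :> R by rewrite ltr0n.
by rewrite /sphere_area -h; field; rewrite !gt_eqF.
Qed.

End euclid.

(** * The Bessel function as an entire radial profile *)

Section bessel_profile.
Context {R : realType}.
Variable N : nat.
Hypothesis N0 : (0 < N)%N.

(** With [mu = (N - 2) / 2], the function
    [x => Gamma_fun (N / 2) * (x / 2) `^ (- mu) * besselJ mu x] is an entire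
    function of [x ^+ 2]; these are its coefficients. *)
Definition profile_coef (k : nat) : R :=
  Gamma_fun (N%:R / 2) * (-1) ^+ k /
    (k`!%:R * Gamma_fun (k%:R + N%:R / 2) * 4 ^+ k).

Local Notation b := profile_coef.

(** The [i]-th derivative of the entire function above. *)
Definition profile (i : nat) (z : R) : R :=
  limn (pseries (iter i (@pseries_diffs R) b) z).

Let n0 : 0 < N%:R / 2 :> R. Proof. by rewrite divr_gt0// ltr0n. Qed.

Lemma Gamma_fun_shift_gt0 (k : nat) : 0 < Gamma_fun (k%:R + N%:R / 2 : R).
Proof.
elim: k => [|k IH]; first by rewrite add0r Gamma_fun_half_gt0.
by rewrite -natr1 addrAC Gamma_funS ?mulr_gt0// ltr_wpDl.
Qed.

Lemma profile_coefS (k : nat) :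
  4 * k.+1%:R * (k%:R + N%:R / 2) * b k.+1 = - b k.
Proof.
rewrite /b -[in Gamma_fun (k.+1%:R + _)]natr1 (addrAC k%:R).
rewrite Gamma_funS; last by rewrite ltr_wpDl.
have h1 := Gamma_fun_shift_gt0 k.
have h2 : 0 < k%:R + N%:R / 2 :> R by rewrite ltr_wpDl.
have h3 : 0 < k`!%:R :> R by rewrite ltr0n fact_gt0.
have h4 : 0 < 4 ^+ k :> R by rewrite exprn_gt0.
have h5 : 0 < k.+1%:R :> R by rewrite ltr0n.
have h6 : 0 < 1 + k%:R :> R by rewrite ltr_wpDr.
have h7 : 0 < k%:R * 2 + N%:R :> R by rewrite ltr_wpDl ?mulr_ge0// ltr0n.
rewrite factS natrM !exprS; field.
by rewrite !gt_eqF.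
Qed.

(** The recurrence divides by [4 * (k + N / 2) >= 1] and by [k.+1], while
    differentiation only multiplies by [k.+1]: all the derivatives are
    dominated coefficientwise by the exponential series. *)
Lemma profile_coef_le (i k : nat) :
  `|iter i (@pseries_diffs R) b k| <= k`!%:R^-1.
Proof.
elim: i k => [k|i IH k].
  elim: k => [|k IH] /=.
    rewrite /b expr0 fact0 mulr1 mul1r add0r mulr1 divff ?normr1 ?invr1//.
    by rewrite gt_eqF// Gamma_fun_half_gt0.
  have h2 : 1 <= 4 * (k%:R + N%:R / 2) :> R.
    rewrite mulrDr -[leLHS]add0r lerD// ?mulr_ge0//.
    have : 1 <= N%:R :> R by rewrite ler1n.
    lra.
  have := profile_coefS k => /(congr1 Num.norm); rewrite normrN => h.
  have h5 : 0 < k.+1%:R :> R by rewrite ltr0n.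
  have h6 : k.+1%:R * `|b k.+1| <= `|b k|.
    move: (b k.+1) (b k) h => B B' <-.
    set c := _ + _ in h2 *.
    have -> : `|4 * k.+1%:R * c * B| = 4 * c * (k.+1%:R * `|B|).
      have c0 : 0 <= c by rewrite addr_ge0// ltW.
      rewrite !normrM (gtr0_norm h5) (ger0_norm c0) (ger0_norm (x := 4))//.
      by ring.
    by rewrite ler_peMl// mulr_ge0// normr_ge0.
  rewrite factS natrM invfM -ler_pdivrMl ?invr_gt0// invrK.
  exact: le_trans IH.
rewrite iterS /pseries_diffs normrM ger0_norm//.
have := IH k.+1; rewrite factS natrM invfM -ler_pdivrMl ?invr_gt0 ?ltr0n//.
by rewrite invrK.
Qed.

Lemma is_cvg_profile (i : nat) (z : R) :
  cvgn (pseries (iter i (@pseries_diffs R) b) z).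
Proof.
apply: normed_cvg.
apply: (@series_le_cvg _ _ (exp_coeff `|z|)) => [k|k|k|].
- exact: normr_ge0.
- by rewrite exp_coeff_ge0.
- rewrite /exp_coeff /= normrM normrX mulrC ler_wpM2l//.
  exact: profile_coef_le.
- exact: is_cvg_series_exp_coeff.
Qed.

Lemma is_derive_profile (i : nat) (z : R) :
  is_derive z 1 (profile i) (profile i.+1 z).
Proof.
apply: (@pseries_snd_diffs R (iter i (@pseries_diffs R) b) (`|z| + 1)).
- exact: is_cvg_profile.
- exact: (@is_cvg_profile i.+1).
- exact: (@is_cvg_profile i.+2).
- by rewrite (ger0_norm (x := _ + 1)) ?addr_ge0// ltrDl.
Qed.

(** Bessel's equation. [z * profile 2 z] is summed as the series of general
    term [i * c i * z ^+ i], where [c] are the coefficients of [profile 1]. *)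
Lemma profile_ode (z : R) :
  4 * z * profile 2 z + 2 * N%:R * profile 1 z + profile 0 z = 0.
Proof.
have c2 : z * (series (fun i => i%:R * pseries_diffs b i * z ^+ i.-1) n) @[n --> \oo]
    --> z * profile 2 z.
  by apply: cvgMr; exact: (pseries_diffs_equiv (@is_cvg_profile 2 z)).
have c1 : pseries (iter 1 (@pseries_diffs R) b) z @ \oo --> profile 1 z.
  exact: is_cvg_profile.
have c0 : pseries (iter 0 (@pseries_diffs R) b) z @ \oo --> profile 0 z.
  exact: is_cvg_profile.
have : (4 * (z * series (fun i => i%:R * pseries_diffs b i * z ^+ i.-1) n) +
    2 * N%:R * pseries (iter 1 (@pseries_diffs R) b) z n +
    pseries (iter 0 (@pseries_diffs R) b) z n) @[n --> \oo] -->
    4 * (z * profile 2 z) + 2 * N%:R * profile 1 z + profile 0 z.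
  by apply: cvgD c0; apply: cvgD; apply: cvgM => //; exact: cvg_cst.
rewrite [4 * (z * profile _ _)]mulrA.
have -> : (fun n => 4 * (z * series (fun i => i%:R * pseries_diffs b i * z ^+ i.-1) n) +
    2 * N%:R * pseries (iter 1 (@pseries_diffs R) b) z n +
    pseries (iter 0 (@pseries_diffs R) b) z n) = fun=> 0; last first.
  by move=> h; exact: cvg_unique h (cvg_cst 0).
apply/funext => n /=; rewrite /pseries /series/=.
rewrite !mulr_sumr -!big_split/= big1// => i _.
have := profile_coefS i; rewrite /pseries_diffs => h.
case: i h => [|i] h; rewrite ?expr0 ?exprS.
  by rewrite !mul0r !mulr0 add0r; lra.
rewrite /=.
have -> : b i.+1 = - (4 * i.+2%:R * (i.+1%:R + N%:R / 2) * b i.+2) by rewrite h opprK.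
by field.
Qed.

Lemma profile0 : profile 0 0 = 1.
Proof.
rewrite /profile /=; apply/cvg_lim => //; rewrite -cvg_shiftS /=.
suff -> : (fun k => pseries b 0 k.+1) = fun=> 1 by exact: cvg_cst.
apply/funext => k; rewrite /pseries /series/= big_nat_recl//= big1.
  rewrite /b !expr0 fact0 !mulr1 mul1r add0r divff ?addr0//.
  by rewrite gt_eqF// Gamma_fun_half_gt0.
by move=> i _; rewrite exprS mul0r mulr0.
Qed.

Lemma besselJ_profile (x : R) : 0 < x ->
  besselJ ((N%:R - 2) / 2) x =
  (x / 2) `^ ((N%:R - 2) / 2) / Gamma_fun (N%:R / 2) * profile 0 (x ^+ 2).
Proof.
move=> x0; rewrite /besselJ.
set C := (X in X * profile _ _).
have : C * pseries b (x ^+ 2) n @[n --> \oo] --> C * profile 0 (x ^+ 2).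
  by apply: cvgMr; exact: (@is_cvg_profile 0).
move=> h; rewrite (_ : series _ = fun n => C * pseries b (x ^+ 2) n).
  exact/cvg_lim.
apply/funext => n; rewrite /pseries /series/= mulr_sumr.
apply: eq_bigr => k _.
have x2 : 0 < x / 2 by rewrite divr_gt0.
rewrite powRD; last by rewrite (gt_eqF x2) implybT.
rewrite powRrM powR_mulrn ?powR_ge0// powR_mulrn ?ltW//.
have -> : k%:R + (N%:R - 2) / 2 + 1 = k%:R + N%:R / 2 :> R by field.
have h1 := Gamma_fun_shift_gt0 k.
have h2 := Gamma_fun_half_gt0 (R := R) N0.
have h3 : 0 < k`!%:R :> R by rewrite ltr0n fact_gt0.
rewrite /C /b expr_div_n exprMn exprVn -exprM.
have -> : (2 ^+ 2) = 4 :> R by rewrite expr2; ring.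
by field; rewrite !gt_eqF// exprn_gt0.
Qed.

(** The power and the Gamma factor do not vanish, so both functions have the
    same zeros; positivity before the first one follows from [profile0] and
    the intermediate value theorem. *)
Lemma profile_first_zero (j : R) :
  is_first_positive_zero (besselJ ((N%:R - 2) / 2)) j ->
  [/\ 0 < j, profile 0 (j ^+ 2) = 0 &
    forall z, 0 <= z < j ^+ 2 -> 0 < profile 0 z].
Proof.
move=> [j0 Jj Jn].
have C0 (x : R) : 0 < x -> (x / 2) `^ ((N%:R - 2) / 2) / Gamma_fun (N%:R / 2) != 0 :> R.
  move=> x0; rewrite gt_eqF// divr_gt0 ?Gamma_fun_half_gt0// powR_gt0//.
  by rewrite divr_gt0.
split => //.
  apply/eqP; move: Jj; rewrite besselJ_profile// => /eqP.
  by rewrite mulf_eq0 (negbTE (C0 _ j0)).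
have nz (z : R) : 0 <= z -> z < j ^+ 2 -> profile 0 z != 0.
  rewrite le_eqVlt => /predU1P[<- _|z0 zj].
    by rewrite profile0 oner_neq0.
  have s0 : 0 < Num.sqrt z by rewrite sqrtr_gt0.
  have sj : Num.sqrt z < j.
    by rewrite -(ger0_norm (ltW j0)) -sqrtr_sqr ltr_sqrt// exprn_gt0.
  have := Jn _ s0 sj; rewrite besselJ_profile// sqr_sqrtr ?ltW//.
  by rewrite mulf_eq0 negb_or => /andP[].
move=> z /andP[z0 zj]; rewrite ltNge; apply/negP => gz.
have : exists2 c, c \in `[0, z] & profile 0 c = 0.
  apply: (@IVT R (profile 0) 0 z 0 z0).
    apply: continuous_subspaceT => y; exact: is_derive_cvg (is_derive_profile 0 y).
  by rewrite profile0 ge_min gz orbT le_max ler01.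
move=> [c]; rewrite in_itv/= => /andP[c0 cz] /eqP.
by rewrite (negbTE (nz c c0 (le_lt_trans cz zj))).
Qed.

End bessel_profile.

(** * The radial eigenvalue equation *)

Section radial_profile.
Context {R : realType}.
Local Notation mu := (@lebesgue_measure R).

Lemma MVT_between (h dh : R -> R) (s u : R) :
  (forall x : R, is_derive x 1 h (dh x)) ->
  exists2 c, Num.min s u <= c <= Num.max s u & h u - h s = dh c * (u - s).
Proof.
move=> dE.
have ch A : {within A, continuous h}.
  by apply: continuous_subspaceT => y; exact: is_derive_cvg (dE y).
case: (ltgtP s u) => [su|us|->].
- have [c + hc] := MVT su (fun x _ => dE x) (ch _).
  by rewrite in_itv/= => /andP[/ltW h1 /ltW h2]; exists c => //; rewrite h1 h2.
- have [c + hc] := MVT us (fun x _ => dE x) (ch _).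
  rewrite in_itv/= => /andP[/ltW h1 /ltW h2]; exists c; first by rewrite h1 h2.
  by rewrite -opprB hc; ring.
- by exists u; rewrite ?lexx// !subrr mulr0.
Qed.

(** [F (sqn x)] is the integral of [dF] between [sqn x] and [a], and the
    layer-cake formula leaves the integral of [dF t * t `^ (N / 2)], of which
    [t `^ (N / 2) * H t] is an antiderivative. *)
Lemma integral_radial (N : nat) (a : R) (F dF H : R -> R) :
  (0 < N)%N -> 0 < a ->
  (forall s : R, is_derive s 1 F (- dF s)) -> continuous dF ->
  (forall s, 0 <= s <= a -> 0 <= dF s) -> F a = 0 ->
  (forall t : R, 0 < t -> is_derive t 1 (fun t => t `^ (N%:R / 2) * H t)
    (dF t * t `^ (N%:R / 2))) ->
  {for 0, continuous H} ->
  (\int[lebesgue_tuple N]_(x in [set x | (sqn x <= a)%R]) (F (sqn x))%:E =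
   unit_ball_vol N * (a `^ (N%:R / 2) * H a)%:E)%E.
Proof.
move=> N0 a0 dFE cdF dF0 Fa GE cH.
pose q : R -> \bar R := (EFin \o dF) \_ `]0, a].
have mdF : measurable_fun setT dF by exact: continuous_measurable_fun.
have mq : measurable_fun setT q.
  apply/(measurable_restrictT _ _).1 => //.
  by apply: measurable_funTS; apply/measurable_EFinP.
have q0 t : (0 <= q t)%E.
  apply: erestrict_ge0 => {}t /=; rewrite in_itv/= lee_fin => /andP[t0 ta].
  by rewrite dF0// ta ltW.
have := layer_cake N mq q0.
have -> : (\int[mu]_(t in `]0%R, +oo[) (q t * (t `^ (N%:R / 2))%:E) =
    (a `^ (N%:R / 2) * H a)%:E)%E.
  transitivity (\int[mu]_(t in `]0%R, a]) (dF t * t `^ (N%:R / 2))%:E)%E.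
    rewrite integral_mkcond [RHS]integral_mkcond; apply: eq_integral => t _.
    rewrite /q !patchE; case: ifPn => [|/negP] + ; rewrite ?inE/= in_itv/= andbT => t0.
      by case: ifPn => [|_]; rewrite ?EFinM ?mul0e.
    rewrite memNset//= in_itv/=; apply/negP; rewrite negb_and.
    by move/negP : t0 => ->.
  rewrite (@ge0_integral_derive_at0 R _ (fun t => t `^ (N%:R / 2) * H t) a 0)//.
  - by rewrite subr0.
  - move=> t t0; apply: cvgM; first exact: cdF.
    exact: is_derive_cvg (is_derive1_powR _ t0).
  - by move=> t t0 ta; rewrite mulr_ge0 ?powR_ge0// dF0// ta ltW.
  - rewrite -[X in _ --> X](mul0r (H 0)); apply: cvgM.
      by apply: powR_cvg0; rewrite divr_gt0// ltr0n.
    exact: cvg_at_right_filter.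
move=> <-; rewrite integral_mkcond; apply: eq_integral => x _.
rewrite /q -integral_mkcondr patchE.
have s0 := sqn_ge0 x; set s := sqn x in s0 *.
have -> : `]s, +oo[%classic `&` `]0, a]%classic = `]s, a]%classic :> set R.
  apply/seteqP; split => t /=; rewrite !in_itv/= ?andbT.
    by move=> [-> /andP[_ ->]].
  by move=> /andP[st ->]; rewrite st (le_lt_trans s0 st).
have [sa|sa|sa] := ltgtP s a; last first.
- rewrite sa mem_set/=; last by rewrite -sa.
  by rewrite set_itvoc0 integral_set0 Fa.
- rewrite memNset/=; last by apply/negP; rewrite -ltNge.
  by rewrite set_itv_ge ?integral_set0// bnd_simp -leNgt ltW.
rewrite mem_set/=; last by rewrite ltW.
rewrite integral_itv_obnd_cbnd; last first.
  by apply: measurable_funTS; apply/measurable_EFinP.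
rewrite (@continuous_FTC2 R dF (fun t => - F t) s a)//.
- by rewrite Fa oppr0 sub0e EFinN oppeK.
- by apply: continuous_subspaceT.
- split.
  + by move=> t _; apply: derivableN; have [] := dFE t.
  + apply: cvg_at_right_filter; apply: cvgN; exact: is_derive_cvg (dFE s).
  + apply: cvg_at_left_filter; apply: cvgN; exact: is_derive_cvg (dFE a).
- move=> t _; rewrite derive1E deriveN; last by have [] := dFE t.
  by have [_ ->] := dFE t; rewrite opprK.
Qed.

Variables (N : nat) (a lam L : R) (f f1 f2 : R -> R).
Hypotheses (N0 : (0 < N)%N) (a0 : 0 < a) (lam0 : 0 < lam) (L0 : 0 <= L).
Hypothesis df : forall s : R, is_derive s 1 f (f1 s).
Hypothesis df1 : forall s : R, is_derive s 1 f1 (f2 s).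
Hypothesis ode : forall s, 2 * s * f2 s + N%:R * f1 s = - lam * f s.
Hypothesis lip : forall s t, 0 <= s <= a -> 0 <= t <= a ->
  `|f2 s - f2 t| <= L * `|s - t|.
Hypothesis f_gt0 : forall s, 0 <= s < a -> 0 < f s.
Hypothesis fa : f a = 0.

Let NR0 : 0 < N%:R :> R. Proof. by rewrite ltr0n. Qed.

(** [r ^+ N * f1 (r ^+ 2)] vanishes at [0] and has derivative
    [- lam * r ^+ N.-1 * f (r ^+ 2)], which is negative. *)
Lemma profile_slope_lt0 s : 0 <= s <= a -> f1 s < 0.
Proof.
move=> /andP[]; rewrite le_eqVlt => /predU1P[<- _|s0 sa].
  have := ode 0; rewrite mulr0 mul0r add0r => h.
  rewrite -(pmulr_rlt0 _ NR0) h mulNr oppr_lt0 mulr_gt0//.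
  by rewrite f_gt0// lexx.
pose W (r : R) := r ^+ N * f1 (r ^+ 2).
have dW (r : R) : is_derive r 1 W (- lam * (r ^+ N.-1 * f (r ^+ 2))).
  have dr2 : is_derive r 1 (fun r : R => f1 (r ^+ 2)) (2 * r * f2 (r ^+ 2)).
    have h : is_derive r 1 (fun r : R => r ^+ 2) (2 * r).
      by apply: is_derive_eq; rewrite /GRing.scale/=; ring.
    by rewrite mulrC; exact: (@is_derive1_comp R f1 (fun r => r ^+ 2)).
  have dN : is_derive r 1 (fun r : R => r ^+ N) (N%:R * r ^+ N.-1).
    have -> : (fun r : R => r ^+ N) = (id : R -> R) ^+ N.
      by apply/funext => x; rewrite exprfctE.
    by have := is_deriveX N (is_derive_id r (1 : R)); rewrite /GRing.scale/= mulr1.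
  have := is_deriveM dN dr2; rewrite /GRing.scale/= => /is_derive_eq; apply.
  have -> : - lam * (r ^+ N.-1 * f (r ^+ 2)) = r ^+ N.-1 * (- lam * f (r ^+ 2)) by ring.
  rewrite -ode; case: (N) N0 => // n _ /=; rewrite exprS /GRing.scale/=; ring.
set r := Num.sqrt s; have r0 : 0 < r by rewrite sqrtr_gt0.
have r2 : r ^+ 2 = s by rewrite sqr_sqrtr// ltW.
have cW : {within `[0, r], continuous W}.
  by apply: continuous_subspaceT => y; exact: is_derive_cvg (dW y).
have [c + hc] := MVT r0 (fun x _ => dW x) cW.
rewrite in_itv/= => /andP[c0 cr].
have : W r < 0.
  move: hc; rewrite {2}/W expr0n gtn_eqF// mul0r !subr0 => ->.
  rewrite !mulNr oppr_lt0 !mulr_gt0// ?exprn_gt0// f_gt0// exprn_ge0 ?ltW//=.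
  by rewrite (lt_le_trans _ sa)// -r2 ltr_pXn2r// ?nnegrE ltW.
by rewrite /W r2 pmulr_rlt0// exprn_gt0.
Qed.

Local Notation n := (N%:R / 2 : R).
Let n0 : 0 < n. Proof. by rewrite divr_gt0. Qed.

(** By the differential equation, [- t `^ (N / 2) * f1 t] is the derivative of
    [- t `^ (N / 2) * (N / lam * f1 t + f t)]. *)
Lemma integral_profile :
  (\int[lebesgue_tuple N]_(x in [set x | (sqn x <= a)%R]) (f (sqn x))%:E =
   unit_ball_vol N * (a `^ n * (N%:R / lam * - f1 a))%:E)%E.
Proof.
have h1 (s : R) : is_derive s 1 f (- - f1 s) by rewrite opprK.
have h2 : continuous (fun s => - f1 s).
  by move=> s; apply: cvgN; exact: is_derive_cvg (df1 s).
have h3 s : 0 <= s <= a -> 0 <= - f1 s.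
  by move=> sa; rewrite oppr_ge0 ltW// profile_slope_lt0.
have h4 (t : R) : 0 < t -> is_derive t 1
    (fun t => t `^ n * (- (N%:R / lam) * f1 t - f t)) (- f1 t * t `^ n).
  move=> t0; have dp := is_derive1_powR n t0.
  have tp : t `^ n = t * t `^ (n - 1) by rewrite mulr_powRB1// ltW.
  apply: is_derive_eq; rewrite /GRing.scale/= tp.
  have -> : f t = - (2 * t * f2 t + N%:R * f1 t) / lam.
    by rewrite ode; field; rewrite gt_eqF.
  by field; rewrite gt_eqF.
have h5 : {for 0, continuous (fun t => - (N%:R / lam) * f1 t - f t)}.
  apply: cvgB; last exact: is_derive_cvg (df 0).
  by apply: cvgM; [exact: cvg_cst|exact: is_derive_cvg (df1 0)].
rewrite (integral_radial N0 a0 h1 h2 h3 fa h4 h5).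
by rewrite fa subr0 mulrN mulNr.
Qed.

(** Lommel's integral of the square of a Bessel function: the function [H] of
    the proof is the factor of [t `^ (N / 2)] in the antiderivative. *)
Lemma integral_profile_sqr :
  (\int[lebesgue_tuple N]_(x in [set x | (sqn x <= a)%R]) (f (sqn x) ^+ 2)%:E =
   unit_ball_vol N * (a `^ n * (N%:R / lam * (a * f1 a ^+ 2)))%:E)%E.
Proof.
pose H t := N%:R / lam * (t * f1 t ^+ 2 - (1 - n) * (f t * f1 t)) +
  (n - 1) * f t ^+ 2.
have dH (t : R) : is_derive t 1 H (N%:R / lam *
   (f1 t ^+ 2 + t * (2 * f1 t * f2 t) - (1 - n) * (f1 t * f1 t + f t * f2 t)) +
   (n - 1) * (2 * f t * f1 t)).
  by rewrite /H; apply: is_derive_eq; rewrite /GRing.scale/=; ring.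
have h1 (s : R) : is_derive s 1 (fun s => f s ^+ 2) (- - (2 * f s * f1 s)).
  by apply: is_derive_eq; rewrite /GRing.scale/=; ring.
have h2 : continuous (fun s => - (2 * f s * f1 s)).
  move=> s; apply: cvgN; apply: cvgM; last exact: is_derive_cvg (df1 s).
  by apply: cvgM; [exact: cvg_cst|exact: is_derive_cvg (df s)].
have h3 s : 0 <= s <= a -> 0 <= - (2 * f s * f1 s).
  move=> sa; rewrite oppr_ge0 mulr_ge0_le0//; last by rewrite ltW// profile_slope_lt0.
  rewrite mulr_ge0//; move: sa => /andP[s0]; rewrite le_eqVlt => /predU1P[->|sa].
    by rewrite fa.
  by rewrite ltW// f_gt0// s0.
have h4 (t : R) : 0 < t -> is_derive t 1 (fun t => t `^ n * H t)
    (- (2 * f t * f1 t) * t `^ n).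
  move=> t0; have dp := is_derive1_powR n t0.
  have tp : t `^ n = t * t `^ (n - 1) by rewrite mulr_powRB1// ltW.
  apply: is_derive_eq; rewrite /GRing.scale/= /H tp.
  have -> : f t = - (2 * t * f2 t + N%:R * f1 t) / lam.
    by rewrite ode; field; rewrite gt_eqF.
  by field; rewrite gt_eqF.
have h0 : f a ^+ 2 = 0 by rewrite fa expr0n.
rewrite (integral_radial N0 a0 h1 h2 h3 h0 h4 (is_derive_cvg (dH 0))).
by rewrite /H fa expr0n/= mul0r !mulr0 subr0 addr0.
Qed.

Let between s u c : 0 <= s <= a -> 0 <= u <= a ->
  Num.min s u <= c <= Num.max s u ->
  0 <= c <= a /\ `|c - s| <= `|u - s|.
Proof.
move=> /andP[s0 sa] /andP[u0 ua].
have [su|us] := leP s u => /andP[h1 h2].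
  split; first by apply/andP; split; lra.
  by rewrite !ger0_norm; lra.
split; first by apply/andP; split; lra.
by rewrite !ler0_norm; lra.
Qed.

Lemma profile_slope_taylor s u : 0 <= s <= a -> 0 <= u <= a ->
  `|f1 u - f1 s - f2 s * (u - s)| <= L * `|u - s| ^+ 2.
Proof.
move=> sa ua; have [c hc ->] := MVT_between s u df1.
have [ca cs] := between sa ua hc.
rewrite -mulrBl normrM expr2 mulrA ler_wpM2r//.
by rewrite (le_trans (lip ca sa))// ler_wpM2l.
Qed.

Lemma profile_taylor s u : 0 <= s <= a -> 0 <= u <= a ->
  `|f u - f s - f1 s * (u - s) - f2 s * (u - s) ^+ 2 / 2| <= L * `|u - s| ^+ 3.
Proof.
move=> sa ua.
pose r v := f v - f1 s * (v - s) - f2 s * (v - s) ^+ 2 / 2.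
have dr (v : R) : is_derive v 1 r (f1 v - f1 s - f2 s * (v - s)).
  by rewrite /r; apply: is_derive_eq; rewrite /GRing.scale/=; field.
have [c hc rc] := MVT_between s u dr.
have [ca cs] := between sa ua hc.
have -> : f u - f s - f1 s * (u - s) - f2 s * (u - s) ^+ 2 / 2 = r u - r s.
  by rewrite /r subrr expr0n/= !mulr0 mul0r !subr0; ring.
rewrite rc normrM exprSr mulrA ler_wpM2r//.
rewrite (le_trans (profile_slope_taylor sa ca))// ler_wpM2l//.
by rewrite lerXn2r// nnegrE.
Qed.

(** This replaces the statement that [f] cut off at [a] is a subsolution.
    Beyond [a] the second-order Taylor polynomial at [s] exceeds the one at [a]
    by at most a cubic term; the latter is
    [f1 a * (de - K * de ^+ 2)] with [de = u - a], because the equation gives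
    [f2 a = - N * f1 a / (2 * a)]. Since [f1 a < 0] and
    [K * de ^+ 2 - de <= K ^+ 2 * de ^+ 3], it is also at most cubic. *)
Lemma profile_taylor_positive_part : exists2 C, 0 <= C &
  forall s u, 0 <= s <= a -> 0 <= u ->
  f s + f1 s * (u - s) + f2 s * (u - s) ^+ 2 / 2 - C * `|u - s| ^+ 3 <=
  (if u <= a then f u else 0).
Proof.
have aa : 0 <= a <= a by rewrite lexx ltW.
pose K := N%:R / (4 * a); pose be := - f1 a.
have be0 : 0 < be by rewrite oppr_gt0 profile_slope_lt0.
have K0 : 0 < K by rewrite divr_gt0// mulr_gt0.
have CL : L <= L + be * K ^+ 2 by rewrite lerDl mulr_ge0 ?exprn_ge0 ?ltW.
exists (L + be * K ^+ 2); first exact: le_trans CL.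
move=> s u sa u0; case: (leP u a) => ua.
  have ua' : 0 <= u <= a by rewrite u0.
  have := profile_taylor sa ua'; rewrite ler_norml => /andP[h _].
  have : L * `|u - s| ^+ 3 <= (L + be * K ^+ 2) * `|u - s| ^+ 3.
    by rewrite ler_wpM2r// exprn_ge0.
  lra.
have [s0 sa'] := andP sa.
have := profile_taylor sa aa; rewrite fa ler_norml (ger0_norm (x := a - s)) ?subr_ge0// => /andP[t0 _].
have := profile_slope_taylor sa aa; rewrite ler_norml (ger0_norm (x := a - s)) ?subr_ge0// => /andP[t1 _].
have := lip sa aa; rewrite ler_norml distrC (ger0_norm (x := a - s)) ?subr_ge0// => /andP[_ t2].
have f2a : f2 a = 2 * be * K.
  have := ode a; rewrite fa mulr0 => /eqP; rewrite addr_eq0 => /eqP h.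
  apply: (mulfI (_ : 2 * a != 0)); first by rewrite gt_eqF// mulr_gt0.
  by rewrite h /K /be; field; rewrite gt_eqF.
rewrite ger0_norm; last by rewrite subr_ge0; lra.
set ep := a - s in t0 t1 t2.
have ep0 : 0 <= ep by rewrite subr_ge0.
pose de := u - a; have de0 : 0 <= de by rewrite subr_ge0 ltW.
have -> : u - s = ep + de by rewrite /ep /de; ring.
(* [1 - v + v ^+ 2 >= 0] for [v = K * de] *)
have k1 : 0 <= be * (de * (1 - K * de + (K * de) ^+ 2)).
  rewrite !mulr_ge0 ?(ltW be0)//.
  by have : 0 <= (1 - K * de) ^+ 2 + (K * de)^+2 + 1; [rewrite !addr_ge0 ?sqr_ge0|lra].
have k2 : 0 <= de * (L * ep ^+ 2 - (f1 s + be + f2 s * ep)).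
  by apply: mulr_ge0 => //; rewrite /be; lra.
have k3 : 0 <= de ^+ 2 * (L * ep - (f2 s - f2 a)).
  by apply: mulr_ge0; [exact: sqr_ge0|lra].
(* what remains is linear in the monomials in [ep] and [de] below *)
have e1 : 0 <= ep ^+ 2 * de by rewrite mulr_ge0 ?sqr_ge0.
have e2 : 0 <= ep * de ^+ 2 by rewrite mulr_ge0 ?sqr_ge0.
have e3 : 0 <= ep ^+ 3 by rewrite exprn_ge0.
have e4 : 0 <= de ^+ 3 by rewrite exprn_ge0.
have k4 : 0 <= L * (2 * (ep ^+ 2 * de) + 5 / 2 * (ep * de ^+ 2) + de ^+ 3).
  by apply: mulr_ge0 => //; lra.
have k5 : 0 <= be * K ^+ 2 * (3 * (ep ^+ 2 * de) + 3 * (ep * de ^+ 2) + ep ^+ 3).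
  by apply: mulr_ge0; [rewrite mulr_ge0 ?sqr_ge0// ltW|lra].
move: k3; rewrite f2a => k3.
lra.
Qed.

End radial_profile.

(** * One-dimensional Gaussian moments *)

Section gaussian_line.
Context {R : realType}.
Local Notation mu := (@lebesgue_measure R).

(** By [tonelli_level] both sides only depend on the measures of the level
    sets [- f x < t], for which the equality holds by assumption. *)
Lemma ge0_integral_density d (X : measurableType d)
    (m nu : {sigma_finite_measure set X -> \bar R}) (w : X -> \bar R)
    (f : X -> R) :
  measurable_fun setT w -> (forall x, 0 <= w x)%E ->
  (forall A, measurable A -> nu A = \int[m]_(x in A) w x)%E ->
  measurable_fun setT f -> (forall x, 0 <= f x) ->
  (\int[nu]_x (f x)%:E = \int[m]_x (w x * (f x)%:E))%E.
Proof.
move=> mw w0 nuE mf f0.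
(* the integral of [g] over [t > - s] is [s] for [s >= 0] *)
pose g : R -> \bar R := EFin \o \1_(`]-oo, 0[%classic : set R).
have mg : measurable_fun setT g.
  by apply/measurable_EFinP; exact: measurable_indic.
have g0 t : (0 <= g t)%E by rewrite lee_fin.
have mNf : measurable_fun setT (fun x => - f x) by exact: measurableT_comp.
have gE (s : R) : 0 <= s -> (\int[mu]_(t in `](- s)%R, +oo[) g t = s%:E)%E.
  move=> s0; rewrite integral_indic//= (_ : _ `&` _ = `](- s), 0[%classic).
    rewrite lebesgue_measure_itv/= lte_fin oppr_lt0.
    have [s0'|] := ltP 0 s; first by rewrite -EFinB sub0r opprK.
    by move=> s0'; congr EFin; apply/eqP; rewrite eq_le s0.
  apply/seteqP; split => t /=; rewrite !in_itv/= ?andbT; first by move=> [-> ->].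
  by move=> /andP[-> ->].
transitivity (\int[nu]_x (1 * \int[mu]_(t in `](- f x)%R, +oo[) g t))%E.
  by apply: eq_integral => x _; rewrite mul1e gE.
rewrite (tonelli_level nu mNf (measurable_cst 1%E) mg (fun=> lee01) g0).
transitivity (\int[m]_x (w x * \int[mu]_(t in `](- f x)%R, +oo[) g t))%E; last first.
  by apply: eq_integral => x _; rewrite gE.
rewrite (tonelli_level m mNf mw mg w0 g0).
apply: eq_integral => t _; congr (_ * _)%E.
have mA : measurable [set x | - f x < t] by exact: measurable_ltr_set.
by rewrite integral_cst// mul1e; exact: nuE.
Qed.

Local Notation gauss := (@normal_prob R 0 1).
Local Notation pdf := (@normal_pdf R 0 1).

Lemma ge0_integral_normal_prob (m s : R) (f : R -> R) :
  measurable_fun setT f -> (forall x, 0 <= f x) ->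
  (\int[normal_prob m s]_x (f x)%:E = \int[mu]_x (normal_pdf m s x * f x)%:E)%E.
Proof.
move=> mf f0; rewrite (@ge0_integral_density _ (measurableTypeR R) mu (normal_prob m s) (EFin \o normal_pdf m s))//.
- by apply/measurable_EFinP; exact: measurable_normal_pdf.
- by move=> x; rewrite lee_fin normal_pdf_ge0.
Qed.

Lemma normal_pdf01E x : pdf x = normal_peak 1 * expR (- (x ^+ 2 / 2)).
Proof.
by rewrite normal_pdfE ?oner_neq0// /normal_fun subr0 expr1n mulNr.
Qed.

Let is_derive_pdf (x : R) : is_derive x 1 pdf (- (x * pdf x)).
Proof.
have -> : pdf = (fun x => normal_peak 1 * expR (- (x ^+ 2 / 2))).
  by apply/funext => y; exact: normal_pdf01E.
have h : is_derive x 1 (fun x : R => - (x ^+ 2 / 2)) (- x).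
  by apply: is_derive_eq; rewrite /GRing.scale/=; field.
have h2 := @is_derive1_comp R expR (fun x => - (x ^+ 2 / 2)) x _ _ (is_derive_expR _) h.
have := is_deriveZ (normal_peak 1) h2; rewrite /GRing.scale/= => /is_derive_eq; apply.
by rewrite /comp; ring.
Qed.

Let measurable_pdf : measurable_fun setT pdf.
Proof. exact: measurable_normal_pdf. Qed.

Let integral_tail_pdf (a : R) : 0 <= a ->
  (\int[mu]_(x in `]a, +oo[) (x * pdf x)%:E = (pdf a)%:E)%E.
Proof.
move=> a0; rewrite integral_itv_obnd_cbnd; last first.
  by apply: measurable_funTS; apply/measurable_EFinP; exact: measurable_funM.
have dN (x : R) : is_derive x 1 (fun x => - pdf x) (x * pdf x).
  by have := is_deriveN (is_derive_pdf x); rewrite opprK.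
rewrite (@ge0_continuous_FTC2y R (fun x => x * pdf x) (fun x => - pdf x) a 0)//.
- by rewrite -EFinB sub0r opprK.
- by move=> x ax; rewrite mulr_ge0 ?normal_pdf_ge0// (le_trans a0).
- apply: continuous_subspaceT => x; apply: cvgM; first exact: cvg_id.
  exact: is_derive_cvg (is_derive_pdf x).
- rewrite -[X in _ --> X]oppr0; apply: cvgN.
  have -> : pdf = (fun x => normal_peak 1 * expR (- (x ^+ 2 / 2))).
    by apply/funext => y; exact: normal_pdf01E.
  rewrite -[X in _ --> X](mulr0 (normal_peak 1)); apply: cvgM; first exact: cvg_cst.
  apply: (cvg_comp (fun x : R => x ^+ 2 / 2) (fun x => expR (- x))); last exact: cvgr_expR.
  by apply: gt0_cvgMly; [rewrite invr_gt0|exact: cvgr_expr2].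
- apply: cvg_at_right_filter; exact: is_derive_cvg (dN a).
- by move=> x _; rewrite derive1E; have [_ ->] := dN x.
Qed.

(** [x * pdf x] has tail integral [pdf u] over [x > u], so by [tonelli_level]
    the integral of [x * (x * pdf x)] over the half-line is that of [pdf]. *)
Lemma integral_gauss_sqr : (\int[gauss]_x (x ^+ 2)%:E = 1%:E)%E.
Proof.
rewrite ge0_integral_normal_prob//; last by move=> x; exact: sqr_ge0.
have cpdf : continuous pdf by move=> x; exact: is_derive_cvg (is_derive_pdf x).
have pdfN x : pdf (- x) = pdf x by rewrite !normal_pdf01E sqrrN.
have set0y : [set x : R | 0 <= x] = `[0, +oo[%classic.
  by apply/seteqP; split => x /=; rewrite in_itv/= andbT.
have h1 : (\int[mu]_x (pdf x * x ^+ 2)%:E =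
    2%:E * \int[mu]_(x in `]0%R, +oo[) (pdf x * x ^+ 2)%:E)%E.
  rewrite ge0_symfun_integralT.
  - rewrite set0y -integral_itv_obnd_cbnd//.
    apply: measurable_funTS; apply/measurable_EFinP; exact: measurable_funM.
  - by move=> x; rewrite mulr_ge0 ?normal_pdf_ge0 ?sqr_ge0.
  - by move=> x; apply: cvgM; [exact: cpdf|exact: exprn_continuous].
  - by move=> x /=; rewrite pdfN sqrrN.
have h2 : (\int[mu]_x (pdf x)%:E = 2%:E * \int[mu]_(x in `]0%R, +oo[) (pdf x)%:E)%E.
  rewrite ge0_symfun_integralT//.
  - rewrite set0y -integral_itv_obnd_cbnd//.
    apply: measurable_funTS; exact/measurable_EFinP.
  - by move=> x; rewrite normal_pdf_ge0.
  - by move=> x /=; rewrite pdfN.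
transitivity (\int[mu]_x (pdf x)%:E)%E; last exact: integral_normal_pdf.
rewrite h2; apply: (eq_trans h1); congr (_ * _)%E.
pose f : R -> \bar R := EFin \o \1_(`]0, +oo[%classic : set R).
have mf : measurable_fun setT f.
  by apply/measurable_EFinP; exact: measurable_indic.
have f0 t : (0 <= f t)%E by rewrite lee_fin.
pose g : R -> \bar R := (fun t => (t * pdf t)%:E) \_ `]0, +oo[.
have mg : measurable_fun setT g.
  apply/(measurable_restrictT _ _).1 => //; apply: measurable_funTS.
  by apply/measurable_EFinP; exact: measurable_funM.
have g0 t : (0 <= g t)%E.
  apply: erestrict_ge0 => u /=; rewrite in_itv/= andbT lee_fin => u0.
  by rewrite mulr_ge0 ?normal_pdf_ge0 ?ltW.
have := tonelli_level mu (@measurable_id _ _ setT) mf mg f0 g0.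
have -> : (\int[mu]_x (f x * \int[mu]_(t in `]x, +oo[) g t) =
    \int[mu]_(x in `]0%R, +oo[) (pdf x)%:E)%E.
  rewrite [RHS]integral_mkcond; apply: eq_integral => x _.
  rewrite patchE /f/= indicE; case: ifPn => x0; last by rewrite mul0e.
  rewrite mul1e; move: x0; rewrite inE/= in_itv/= andbT => x0.
  rewrite -integral_tail_pdf ?ltW//; apply: eq_integral => t.
  rewrite inE/= in_itv/= andbT /g patchE => xt.
  by rewrite mem_set//= in_itv/= andbT (lt_trans x0).
move=> ->; rewrite integral_mkcond; apply: eq_integral => t _.
rewrite /g !patchE; case: ifPn => [|_]; last by rewrite mul0e.
rewrite inE/= in_itv/= andbT => t0.
rewrite integral_indic//=; last by apply: (@measurable_ltr_set R _ (measurableTypeR R) id (cst t)).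
rewrite (_ : _ `&` _ = `]0, t[%classic); last first.
  apply/seteqP; split => u /=; rewrite !in_itv/= ?andbT; first by move=> [-> ->].
  by move=> /andP[-> ->].
rewrite lebesgue_measure_itv/= lte_fin t0 sube0 -EFinM; congr EFin; ring.
Qed.

(** [x ^+ 6 <= 384 * expR (x ^+ 2 / 4)], where [384 = 3`! * 4 ^+ 3], and
    [expR (x ^+ 2 / 4) * pdf x] is a multiple of a Gaussian density of
    variance [2]. *)
Lemma integral_gauss_pow6_lty : (\int[gauss]_x (x ^+ 6)%:E < +oo)%E.
Proof.
rewrite ge0_integral_normal_prob//; last by move=> x; rewrite (exprM x 2 3) exprn_ge0 ?sqr_ge0.
pose s : R := Num.sqrt 2.
have s0 : s != 0 by rewrite gt_eqF ?sqrtr_gt0.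
pose C : R := 384 * (normal_peak 1 / normal_peak s).
have C0 : 0 <= C by rewrite mulr_ge0// divr_ge0// normal_peak_ge0.
apply: (@le_lt_trans _ _ (\int[mu]_x (C%:E * (normal_pdf 0 s x)%:E))%E); last first.
  rewrite ge0_integralZl//.
  - by rewrite integral_normal_pdf mule1 ltry.
  - by apply/measurable_EFinP; exact: measurable_normal_pdf.
  - by move=> x _; rewrite lee_fin normal_pdf_ge0.
apply: ge0_le_integral => //.
- move=> x _; rewrite lee_fin mulr_ge0 ?normal_pdf_ge0// (exprM x 2 3) exprn_ge0 ?sqr_ge0//.
- by apply/measurable_EFinP; exact: measurable_funM.
- by apply: measurable_funeM; apply/measurable_EFinP; exact: measurable_normal_pdf.
move=> x _; rewrite -EFinM lee_fin normal_pdf01E normal_pdfE// /normal_fun.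
rewrite subr0 sqr_sqrtr//.
have p1 := normal_peak_gt0 (oner_neq0 R); have ps := normal_peak_gt0 s0.
rewrite /C [leRHS](_ : _ = normal_peak 1 * (384 * expR (- x ^+ 2 / (2 *+ 2)))); last first.
  by field; rewrite gt_eqF.
rewrite -mulrA ler_pM2l// mulrC.
rewrite [in leRHS](_ : - x ^+ 2 / (2 *+ 2) = x ^+ 2 / 4 + - (x ^+ 2 / 2)); last by field.
rewrite expRD mulrA ler_pM2r ?expR_gt0//.
have y0 : 0 <= x ^+ 2 / 4 by rewrite divr_ge0 ?sqr_ge0.
have := expR_ge1Dxn 2 y0.
rewrite (exprM x 2 3) (_ : 3`!%:R = 6 :> R)//.
rewrite expr_div_n (_ : 4 ^+ 3 = 64 :> R); last by ring.
by set A := (x ^+ 2) ^+ 3; set E := expR _; lra.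
Qed.

End gaussian_line.

Section gaussian_invariance.
Context {R : realType}.
Local Notation mu := (@lebesgue_measure R).
Local Notation gauss := (@normal_prob R 0 1).
Local Notation pdf := (@normal_pdf R 0 1).

Let measurable_pdf : measurable_fun setT pdf.
Proof. exact: measurable_normal_pdf. Qed.

Lemma lebesgue_measure_oppr (A : set R) : measurable A -> mu A = mu (-%R @^-1` A).
Proof.
move=> mA.
have mf : measurable_fun setT (fun x : measurableTypeR R => - x : measurableTypeR R).
  exact: measurable_funN.
apply: (@lebesgue_measure_unique R (image_measure mu mf)) => // _ [[x y] _ <-].
change (mu `]x, y] = mu ((fun u : R => (- u)%R) @^-1` `]x, y]))%E.
have -> : (fun u : R => - u) @^-1` `]x, y] = `[(- y), (- x)[%classic.
  by apply/seteqP; split => u /=; rewrite !in_itv/= ltrNr lerNl => /andP[-> ->].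
rewrite !lebesgue_measure_itv/= !lte_fin ltrN2.
by case: ifPn => // xy; rewrite -!EFinB opprK addrC.
Qed.

Lemma normal_prob_oppr (A : set R) : measurable A ->
  gauss (-%R @^-1` A) = gauss A.
Proof.
move=> mA.
have mf : measurable_fun setT (fun x : measurableTypeR R => - x : measurableTypeR R).
  exact: measurable_funN.
have mg : measurable_fun setT (fun x => ((EFin \o pdf) \_ A) x).
  by apply/(measurable_restrictT _ _).1 => //; apply: measurable_funTS; exact/measurable_EFinP.
have g0 x : (0 <= ((EFin \o pdf) \_ A) x)%E.
  by apply: erestrict_ge0 => t _; rewrite lee_fin normal_pdf_ge0.
rewrite /normal_prob [RHS]integral_mkcond [LHS]integral_mkcond.
transitivity (\int[image_measure mu mf]_x ((EFin \o pdf) \_ A) x)%E.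
  rewrite ge0_integral_image_measure//; apply: eq_integral => x _.
  rewrite !patchE; have -> : (x \in -%R @^-1` A) = (- x \in A).
    by apply/idP/idP; rewrite !inE.
  by case: ifP => // _ /=; rewrite !normal_pdf01E sqrrN.
apply: eq_measure_integral => B mB _; exact: esym (lebesgue_measure_oppr mB).
Qed.

Lemma normal_prob_scale (c : R) (A : set R) : 0 < c -> measurable A ->
  normal_prob 0 c A = gauss ((fun x => c * x) @^-1` A).
Proof.
move=> c0 mA.
have mg : measurable_fun setT ((EFin \o normal_pdf 0 c) \_ A).
  apply/(measurable_restrictT _ _).1 => //; apply: measurable_funTS; apply/measurable_EFinP.
  exact: measurable_normal_pdf.
have g0 x : (0 <= ((EFin \o normal_pdf 0 c) \_ A) x)%E.
  by apply: erestrict_ge0 => t _; rewrite lee_fin normal_pdf_ge0.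
rewrite /normal_prob integral_mkcond [RHS]integral_mkcond.
rewrite (@ge0_integral_affine R c 0 _ c0 mg g0) -ge0_integralZl//; last 2 first.
- apply: (measurableT_comp mg) => /=.
  apply: (@measurable_funD _ (measurableTypeR R)) => //; exact: measurable_funM.
- by rewrite lee_fin ltW.
apply: eq_integral => x _; rewrite addr0 !patchE.
have -> : (x \in (fun x => c * x) @^-1` A) = (c * x \in A).
  by apply/idP/idP; rewrite !inE.
case: ifP => _ //=; last by rewrite mule0.
rewrite -EFinM normal_pdf01E normal_pdfE ?gt_eqF// /normal_fun.
congr EFin; rewrite subr0 mulrA; congr (_ * expR _).
  rewrite /normal_peak expr1n -!mulrnAr sqrtrM ?sqr_ge0// sqrtr_sqr (gtr0_norm c0).
  by rewrite mul1r invfM mulrA divff ?gt_eqF// mul1r.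
by rewrite -mulr_natr; field; rewrite gt_eqF.
Qed.

End gaussian_invariance.

(** * Gaussian vectors *)

Section mean.
Context d (T : measurableType d) (R : realType) (P : probability T R).

(** Integrability is kept next to the value, so that the moments below
    combine linearly. *)
Definition has_mean (g : T -> R) (v : R) : Prop :=
  P.-integrable setT (EFin \o g) /\ (\int[P]_x (g x)%:E = v%:E)%E.

Lemma has_mean_cst (c : R) : has_mean (fun=> c) c.
Proof.
split; first exact: finite_measure_integrable_cst.
by rewrite integral_cst// [X in (_ * X)%E](_ : _ = 1%E) ?mule1//; exact: probability_setT.
Qed.

Lemma has_meanD g1 g2 v1 v2 : has_mean g1 v1 -> has_mean g2 v2 ->
  has_mean (fun x => g1 x + g2 x) (v1 + v2).
Proof.
move=> [i1 e1] [i2 e2]; split.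
  exact: (integrableD measurableT i1 i2).
under eq_integral do rewrite EFinD.
by rewrite (integralD measurableT i1 i2) e1 e2.
Qed.

Lemma has_meanZ c g v : has_mean g v -> has_mean (fun x => c * g x) (c * v).
Proof.
move=> [i1 e1]; split.
  exact: (integrableZl measurableT c i1).
under eq_integral do rewrite EFinM.
by rewrite (integralZl measurableT i1) e1.
Qed.

Lemma has_mean_sum n (g : 'I_n -> T -> R) (v : 'I_n -> R) :
  (forall i, has_mean (g i) (v i)) ->
  has_mean (fun x => \sum_(i < n) g i x) (\sum_(i < n) v i).
Proof.
elim: n g v => [|n IH] g v h.
  rewrite big_ord0; under eq_fun do rewrite big_ord0; exact: has_mean_cst.
rewrite big_ord_recl; under eq_fun do rewrite big_ord_recl.
by apply: has_meanD => //; exact: IH.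
Qed.

Lemma has_mean_le (f : T -> \bar R) g v : measurable_fun setT f ->
  (forall x, 0 <= f x)%E -> has_mean g v -> (forall x, (g x)%:E <= f x)%E ->
  (v%:E <= \int[P]_x f x)%E.
Proof.
move=> mf f0 [ig ev] gf; rewrite -ev.
have mg : measurable_fun setT g.
  by apply/measurable_EFinP; exact: measurable_int ig.
apply: (@le_trans _ _ (\int[P]_x (Num.max (g x) 0)%:E)%E).
  rewrite integralE -[leRHS]sube0; apply: leeB; last exact: integral_ge0.
  apply: ge0_le_integral => //.
  - exact/measurable_funepos/measurable_EFinP.
  - by apply/measurable_EFinP; apply: measurable_maxr.
  - by move=> x _; rewrite funeposE -EFin_max.
apply: ge0_le_integral => //.
- by move=> x _; rewrite lee_fin le_max lexx orbT.
- by apply/measurable_EFinP; apply: measurable_maxr.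
- by move=> x _; rewrite EFin_max ge_max gf f0.
Qed.

End mean.

Section gaussian_tuple.
Context {R : realType} (N : nat).
Variable P : probability (N.-tuple R) R.
Local Notation gauss := (@normal_prob R 0 1).
Hypothesis P_rect : forall A : 'I_N -> set R, (forall i, measurable (A i)) ->
  P (rect A) = (\prod_(i < N) gauss (A i))%E.

(** Sign changes of coordinates preserve the standard Gaussian law. They kill
    the odd moments and make the walk operator symmetric. *)
Definition tsign (e : 'I_N -> bool) (z : N.-tuple R) : N.-tuple R :=
  [tuple (-1) ^+ e i * tnth z i | i < N].

Lemma measurable_tsign e : measurable_fun setT (tsign e).
Proof.
apply/measurable_fun_tnthP => i /=.
rewrite (_ : _ \o _ = (fun w => (-1) ^+ e i * tnth w i)); last first.
  by apply/funext => w /=; rewrite tnth_mktuple.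
by apply: measurable_funM => //; exact: measurable_tnth.
Qed.

Lemma tsign_invariant e (A : set (N.-tuple R)) : measurable A ->
  P (tsign e @^-1` A) = P A.
Proof.
move=> mA; symmetry.
have PT : (P setT < +oo)%E by rewrite probability_setT ltry.
apply: (@tuple_measure_unique _ _ N R P (image_measure P (measurable_tsign e)) PT) => //.
move=> B mB.
change (P (rect B) = P (tsign e @^-1` rect B)).
pose B' i : set R := if e i then -%R @^-1` B i else B i.
have -> : tsign e @^-1` rect B = rect B'.
  apply/seteqP; split => z /= H i; have := H i; rewrite ?tnth_mktuple /B';
    by case: (e i) => //=; rewrite ?expr1 ?expr0 ?mulN1r ?mul1r.
rewrite !P_rect => [|i|//].
  apply: eq_bigr => i _; rewrite /B'; case: (e i) => //.
  by rewrite normal_prob_oppr.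
rewrite /B'; case: (e i) => //; rewrite -[X in measurable X]setTI.
by apply: (@measurable_funN _ (measurableTypeR R) R setT id) => //.
Qed.

Lemma has_mean_odd e (g : N.-tuple R -> R) :
  P.-integrable setT (EFin \o g) -> (forall z, g (tsign e z) = - g z) ->
  has_mean P g 0.
Proof.
move=> ig godd; split => //.
have hg : has_mean P g (fine (\int[P]_z (g z)%:E)).
  by split => //; rewrite fineK//; exact: integrable_fin_num ig.
have [iN eN] := has_meanZ (-1) hg.
have : (\int[P]_z (g z)%:E = \int[P]_z (-1 * g z)%:E)%E.
  transitivity (\int[image_measure P (measurable_tsign e)]_z (g z)%:E)%E.
    by apply: eq_measure_integral => A mA _; exact: esym (tsign_invariant e mA).
  have gE : (fun z => (g z)%:E) \o tsign e = (fun z => (-1 * g z)%:E).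
    by apply/funext => z /=; rewrite godd mulN1r.
  rewrite (integral_pushforward (measurable_tsign e))//.
  - by rewrite preimage_setT gE.
  - by have /integrableP[] := ig.
  - by rewrite preimage_setT gE.
have [_ ->] := hg; rewrite eN => -[h]; congr EFin; lra.
Qed.

Lemma gaussian_marginal (i : 'I_N) (A : set R) : measurable A ->
  P ((fun z => tnth z i) @^-1` A) = gauss A.
Proof.
move=> mA.
have -> : (fun z : N.-tuple R => tnth z i) @^-1` A =
    rect (fun k => if k == i then A else setT).
  apply/seteqP; split => z /=; last by move=> /(_ i); rewrite eqxx.
  by move=> h k; case: eqP => // ->.
rewrite P_rect; last by move=> k; case: ifP.
rewrite (bigD1 i)//= eqxx big1 ?mule1// => k /negbTE ->.
exact: probability_setT.
Qed.

Lemma ge0_integral_gaussian_marginal (i : 'I_N) (g : R -> \bar R) :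
  measurable_fun setT g -> (forall x, 0 <= g x)%E ->
  (\int[P]_z g (tnth z i) = \int[gauss]_x g x)%E.
Proof.
move=> mg g0.
have mi : @measurable_fun _ _ (N.-tuple R) (measurableTypeR R) setT
  (fun z => tnth z i) := measurable_tnth i.
rewrite -(ge0_integral_image_measure P mi mg g0).
apply: eq_measure_integral => A mA _; exact: gaussian_marginal.
Qed.

(** Of degree six, like the cube of [sqn (tcomb c z x) - sqn x] in [z]. *)
Definition dominating (z : N.-tuple R) : R := (1 + sqn z) ^+ 3.

Lemma measurable_dominating : measurable_fun setT dominating.
Proof.
apply: measurable_funX; apply: measurable_funD => //; exact: measurable_sqn.
Qed.

(** Iterates [(x + y) ^+ 3 <= 4 * (x ^+ 3 + y ^+ 3)]. *)
Lemma cube_sum_le (n : nat) (y : 'I_n -> R) : (forall i, 0 <= y i) ->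
  (1 + \sum_(i < n) y i) ^+ 3 <= 8 ^+ n * (1 + \sum_(i < n) y i ^+ 3).
Proof.
elim: n y => [|n IH] y y0.
  by rewrite !big_ord0 !addr0 expr1n expr0 mulr1.
rewrite !big_ord_recl [8 ^+ _]exprS.
have := IH (fun i => y (lift ord0 i)) (fun i => y0 _).
set S := \sum_(i < n) _; set S3 := \sum_(i < n) _.
have S0 : 0 <= S by apply: sumr_ge0.
have S30 : 0 <= S3 by apply: sumr_ge0 => i _; rewrite exprn_ge0.
have := y0 ord0; set x := y ord0; set C := 8 ^+ n.
have C1 : 1 <= C by rewrite exprn_ege1// ler1n.
move=> x0 h.
have h1 : (1 + (x + S)) ^+ 3 <= 4 * (x ^+ 3 + (1 + S) ^+ 3).
  have q0 : 0 <= (x + (1 + S)) * (x - (1 + S)) ^+ 2.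
    by rewrite mulr_ge0 ?sqr_ge0// !addr_ge0.
  have : 4 * (x ^+ 3 + (1 + S) ^+ 3) - (1 + (x + S)) ^+ 3 =
    3 * ((x + (1 + S)) * (x - (1 + S)) ^+ 2) by ring.
  lra.
have h2 : 0 <= (C - 1) * x ^+ 3 by rewrite mulr_ge0 ?subr_ge0// exprn_ge0.
have x3 : 0 <= x ^+ 3 by rewrite exprn_ge0.
have h3 : 0 <= C * (1 + S3) by rewrite mulr_ge0 ?addr_ge0// (le_trans _ C1).
lra.
Qed.

Lemma integrable_dominating : P.-integrable setT (EFin \o dominating).
Proof.
apply/integrableP; split.
  by apply/measurable_EFinP; exact: measurable_dominating.
have s0 z : 0 <= dominating z by rewrite exprn_ge0// addr_ge0// sqn_ge0.
under eq_integral do rewrite /= ger0_norm ?s0//.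
have m6 i : measurable_fun setT (fun z : N.-tuple R => (tnth z i ^+ 6)).
  by apply: measurable_funX; exact: measurable_tnth.
have p6 (x : R) : 0 <= x ^+ 6 by rewrite (exprM x 2 3) exprn_ge0// sqr_ge0.
apply: (@le_lt_trans _ _ (\int[P]_z ((8 ^+ N)%:E *
  (1 + \sum_(i < N) (tnth z i ^+ 6)%:E)))%E).
  apply: ge0_le_integral => //.
  - by move=> z _; rewrite lee_fin.
  - by apply/measurable_EFinP; exact: measurable_dominating.
  - apply: measurable_funeM; apply: emeasurable_funD => //.
    by apply: emeasurable_sum => i; apply/measurable_EFinP; exact: m6.
  - move=> z _; rewrite sumEFin -EFinD -EFinM lee_fin.
    have := @cube_sum_le N (fun i => tnth z i ^+ 2) (fun i => sqr_ge0 _).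
    by under [X in _ <= _ * (1 + X) -> _]eq_bigr do rewrite -exprM.
rewrite ge0_integralZl//; last 2 first.
- apply: emeasurable_funD => //.
  by apply: emeasurable_sum => i; apply/measurable_EFinP; exact: m6.
- by move=> z _; rewrite adde_ge0// sume_ge0// => i _; rewrite lee_fin.
apply: lte_mul_pinfty => //.
rewrite ge0_integralD//; last 2 first.
- by move=> z _; apply: sume_ge0 => i _; rewrite lee_fin.
- by apply: emeasurable_sum => i; apply/measurable_EFinP; exact: m6.
apply: lte_add_pinfty.
  by rewrite integral_cst// mul1e (le_lt_trans (probability_le1 _ _))// ltry.
rewrite ge0_integral_sum//; last 2 first.
- by move=> i; apply/measurable_EFinP; exact: m6.
- by move=> i z _; rewrite lee_fin.
apply: lte_sum_pinfty => i _.
rewrite (@ge0_integral_gaussian_marginal i (fun x => (x ^+ 6)%:E)).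
- exact: integral_gauss_pow6_lty.
- by apply/measurable_EFinP; exact: measurable_funX.
- by move=> x; rewrite lee_fin.
Qed.

Let integrable_dominated (g : N.-tuple R -> R) : measurable_fun setT g ->
  (forall z, `|g z| <= dominating z) -> P.-integrable setT (EFin \o g).
Proof.
move=> mg gd.
apply: (le_integrable measurableT _ _ integrable_dominating).
  exact/measurable_EFinP.
move=> z _ /=; rewrite lee_fin (le_trans (gd z))// ler_norm//.
Qed.

Let sqn_coord (z : N.-tuple R) i : tnth z i ^+ 2 <= sqn z.
Proof.
by rewrite /sqn (bigD1 i)//= lerDl sumr_ge0// => k _; exact: sqr_ge0.
Qed.

Let dominating_ge z y : 0 <= y -> y <= 1 + sqn z -> y <= dominating z.
Proof.
move=> y0 h; rewrite (le_trans h)// /dominating -[leLHS]expr1.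
by rewrite ler_weXn2l// lerDl sqn_ge0.
Qed.

Lemma has_mean_coord i : has_mean P (fun z => tnth z i) 0.
Proof.
apply: (@has_mean_odd (fun=> true)).
  apply: integrable_dominated => [|z]; first exact: measurable_tnth.
  apply: dominating_ge => //; have := sqn_coord z i.
  rewrite -[tnth z i ^+ 2]real_normK ?num_real//.
  have := sqr_ge0 (`|tnth z i| - 1); rewrite sqrrB1 mulr2n.
  have : 0 <= `|tnth z i| by []; set y2 := `|tnth z i| ^+ 2.
  by set y := `|tnth z i|; lra.
by move=> z; rewrite tnth_mktuple expr1 mulN1r.
Qed.

Lemma has_mean_coord_mul i j :
  has_mean P (fun z => tnth z i * tnth z j) (i == j)%:R.
Proof.
have ig : P.-integrable setT (EFin \o (fun z => tnth z i * tnth z j)).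
  apply: integrable_dominated => [|z].
    by apply: measurable_funM; exact: measurable_tnth.
  apply: dominating_ge => //.
  have := sqn_coord z i; have := sqn_coord z j.
  rewrite -[tnth z i ^+ 2]real_normK ?num_real// -[tnth z j ^+ 2]real_normK ?num_real//.
  rewrite normrM; have := sqr_ge0 (`|tnth z i| - `|tnth z j|); rewrite sqrrB mulr2n.
  have : 0 <= `|tnth z i| * `|tnth z j| by rewrite mulr_ge0.
  by set x2 := `|tnth z i| ^+ 2; set y2 := `|tnth z j| ^+ 2; set xy := _ * _; lra.
move: ig; have [<- ig|ij ig] := eqVneq i j; last first.
  apply: (@has_mean_odd (fun k => k == i)) => // z.
  by rewrite !tnth_mktuple eqxx eq_sym (negbTE ij) expr1 expr0 mul1r mulN1r mulNr.
split => //; transitivity (\int[gauss]_x (x ^+ 2)%:E)%E; last exact: integral_gauss_sqr.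
apply: (@ge0_integral_gaussian_marginal i (fun x => (x ^+ 2)%:E)).
- by apply/measurable_EFinP; exact: measurable_funX.
- by move=> x; rewrite lee_fin sqr_ge0.
Qed.

Definition dot (x z : N.-tuple R) : R := \sum_(i < N) tnth x i * tnth z i.

Lemma has_mean_dot x : has_mean P (dot x) 0.
Proof.
have := has_mean_sum (fun i => has_meanZ (tnth x i) (has_mean_coord i)).
by rewrite big1// => i _; rewrite mulr0.
Qed.

Lemma has_mean_sqn : has_mean P (@sqn R N) N%:R.
Proof.
have := has_mean_sum (fun i => has_mean_coord_mul i i).
rewrite (eq_bigr (fun=> 1)) ?sumr_const ?card_ord//.
by move=> i _; rewrite eqxx.
Qed.

Lemma has_mean_dot_sqr x : has_mean P (fun z => dot x z ^+ 2) (sqn x).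
Proof.
have := has_mean_sum (fun i => has_meanZ (tnth x i)
  (has_mean_sum (fun j => has_meanZ (tnth x j) (has_mean_coord_mul i j)))).
congr has_mean.
  apply/funext => z; rewrite expr2 {1}/dot mulr_suml; apply: eq_bigr => i _.
  rewrite -mulrA; congr (_ * _); rewrite /dot !mulr_sumr; apply: eq_bigr => j _.
  by ring.
rewrite /sqn; apply: eq_bigr => i _.
rewrite (bigD1 i)//= eqxx mulr1 big1 ?addr0 -?expr2// => j.
by rewrite eq_sym => /negbTE ->; rewrite mulr0.
Qed.

End gaussian_tuple.

(** * One step of the random walk *)

Section gaussian_step.
Context {R : realType} (N : nat).
Variable P : probability (N.-tuple R) R.
Hypothesis P_rect : forall A : 'I_N -> set R, (forall i, measurable (A i)) ->
  P (rect A) = (\prod_(i < N) normal_prob 0 1 (A i))%E.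
Variables (a lam C M : R) (f f1 f2 : R -> R).
Hypotheses (a0 : 0 < a) (C0 : 0 <= C).
Hypothesis ode : forall s, 2 * s * f2 s + N%:R * f1 s = - lam * f s.
Hypothesis f2_le : forall s, 0 <= s <= a -> `|f2 s| <= M.
Hypothesis taylor : forall s u, 0 <= s <= a -> 0 <= u ->
  f s + f1 s * (u - s) + f2 s * (u - s) ^+ 2 / 2 - C * `|u - s| ^+ 3 <=
  (if u <= a then f u else 0).

Lemma sqn_tcomb c (z x : N.-tuple R) :
  sqn (tcomb c z x) = sqn x + (2 * c * dot x z + c ^+ 2 * sqn z).
Proof.
rewrite /sqn /dot !mulr_sumr -!big_split/=; apply: eq_bigr => i _.
by rewrite tnth_mktuple; ring.
Qed.

Lemma dot_le (x z : N.-tuple R) : 2 * `|dot x z| <= sqn x + sqn z.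
Proof.
rewrite /dot /sqn -big_split/= mulrC -ler_pdivlMr//.
apply: (le_trans (ler_norm_sum _ _ _)); rewrite mulr_suml.
apply: ler_sum => i _; rewrite ler_pdivlMr//.
rewrite -[tnth x i ^+ 2]real_normK ?num_real// -[tnth z i ^+ 2]real_normK ?num_real//.
rewrite normrM; have := sqr_ge0 (`|tnth x i| - `|tnth z i|).
by rewrite sqrrB mulr2n; set u := `|_|; set v := `|_|; lra.
Qed.

Let phi (y : N.-tuple R) : R := if sqn y <= a then f (sqn y) else 0.

Let K1 : R := 8 * C * (1 + a) ^+ 3 + M * (2 * (1 + a) + 1) / 2.

Let pointwise c (x z : N.-tuple R) : 0 < c -> c <= 1 -> sqn x <= a ->
  f (sqn x) + (2 * c * f1 (sqn x) * dot x z +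
    (c ^+ 2 * f1 (sqn x) * sqn z + (2 * c ^+ 2 * f2 (sqn x) * dot x z ^+ 2 +
      - (K1 * c ^+ 3) * dominating z))) <= phi (tcomb c z x).
Proof.
move=> c0 c1 sa; set s := sqn x; set p := dot x z; set q := sqn z.
have s0 : 0 <= s by exact: sqn_ge0.
have q0 : 0 <= q by exact: sqn_ge0.
have sa' : 0 <= s <= a by rewrite s0.
have := taylor sa' (sqn_ge0 (tcomb c z x)).
rewrite -/(phi _) [in X in X <= _]sqn_tcomb -/s -/p -/q.
set de := 2 * c * p + c ^+ 2 * q.
have -> : s + de - s = de by ring.
apply: le_trans.
rewrite /dominating -/q; set Q := 1 + q; set A := 1 + a.
have pn : 2 * `|p| <= A * Q.
  have := dot_le x z; rewrite -/p -/s -/q /A /Q => h.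
  have : 0 <= a * q by rewrite mulr_ge0// ltW.
  lra.
have Q1 : 1 <= Q by rewrite lerDl.
have A1 : 1 <= A by rewrite lerDl ltW.
have den : `|de| <= c * (2 * A * Q).
  rewrite /de (le_trans (ler_normD _ _))//.
  rewrite !normrM (ger0_norm (x := 2))// (gtr0_norm c0) (ger0_norm q0).
  have : c * (2 * `|p|) <= c * (A * Q) by rewrite ler_pM2l.
  have : c * (c * q) <= c * (A * Q).
    rewrite ler_pM2l// (@le_trans _ _ q)//; first by rewrite ler_piMl.
    rewrite (@le_trans _ _ Q)//; first by rewrite lerDr.
    by rewrite ler_peMl// (le_trans _ Q1).
  lra.
have de3 : `|de| ^+ 3 <= 8 * c ^+ 3 * (A ^+ 3 * Q ^+ 3).
  apply: (@le_trans _ _ ((c * (2 * A * Q)) ^+ 3)).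
    by rewrite lerXn2r ?nnegrE// (le_trans _ den).
  by rewrite le_eqVlt; apply/orP; left; apply/eqP; ring.
have Cde : C * `|de| ^+ 3 <= C * (8 * c ^+ 3 * (A ^+ 3 * Q ^+ 3)) by rewrite ler_wpM2l.
pose r := 4 * c * p * q + c ^+ 2 * q ^+ 2.
have dr : de ^+ 2 = 4 * c ^+ 2 * p ^+ 2 + c ^+ 2 * r.
  by rewrite /de /r; ring.
have rn : `|r| <= c * ((2 * A + 1) * Q ^+ 3).
  have qQ : q <= Q by rewrite lerDr.
  have Q0 : 0 <= Q by rewrite (le_trans _ Q1).
  have Q23 : Q ^+ 2 <= Q ^+ 3 by rewrite ler_weXn2l.
  have A0 : 0 <= A by rewrite (le_trans _ A1).
  rewrite /r (le_trans (ler_normD _ _))//.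
  rewrite !normrM (ger0_norm (x := 4))// (gtr0_norm c0) (ger0_norm q0).
  have h1 : (2 * `|p|) * q <= (A * Q) * Q by rewrite ler_pM// mulr_ge0.
  have h2 : c * ((2 * `|p|) * q) <= c * (A * Q ^+ 3).
    rewrite ler_pM2l// (le_trans h1)// -mulrA -expr2 ler_wpM2l//.
  have h3 : c ^+ 2 * q ^+ 2 <= c * Q ^+ 3.
    rewrite ler_pM ?exprn_ge0// ?(ltW c0)//.
      by rewrite expr2 ler_piMl// ltW.
    by rewrite (le_trans _ Q23)// lerXn2r.
  lra.
have fr : - (M * (c ^+ 2 * (c * ((2 * A + 1) * Q ^+ 3)))) <= f2 s * (c ^+ 2 * r).
  apply: (@le_trans _ _ (- `|f2 s * (c ^+ 2 * r)|)); last by rewrite lerNl -normrN ler_norm.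
  have c20 : 0 <= c ^+ 2 by rewrite exprn_ge0// ltW.
  rewrite lerN2 (normrM (f2 s)) (normrM (c ^+ 2)) (ger0_norm c20).
  apply: ler_pM => //; [by rewrite mulr_ge0|exact: f2_le|exact: ler_wpM2l].
have -> : f2 s * de ^+ 2 / 2 = 2 * c ^+ 2 * f2 s * p ^+ 2 + f2 s * (c ^+ 2 * r) / 2.
  by rewrite dr; field.
have -> : K1 * c ^+ 3 = 8 * C * A ^+ 3 * c ^+ 3 + M * (2 * A + 1) / 2 * c ^+ 3.
  by rewrite /K1 -/A; ring.
have -> : f1 s * de = 2 * c * f1 s * p + c ^+ 2 * f1 s * q by rewrite /de; ring.
have e1 : C * (8 * c ^+ 3 * (A ^+ 3 * Q ^+ 3)) = 8 * C * A ^+ 3 * c ^+ 3 * Q ^+ 3 by ring.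
have e2 : M * (c ^+ 2 * (c * ((2 * A + 1) * Q ^+ 3))) = M * (2 * A + 1) * c ^+ 3 * Q ^+ 3 by ring.
rewrite e1 in Cde; rewrite e2 in fr.
lra.
Qed.

(** With [s = sqn x] and [de = sqn (tcomb c z x) - s], the Taylor inequality
    bounds [phi (tcomb c z x)] from below by a polynomial in [z]. Its mean is
    [f s + c ^+ 2 * (N * f1 s + 2 * s * f2 s)], that is
    [(1 - lam * c ^+ 2) * f s], up to terms of order [c ^+ 3]. *)
Lemma gaussian_step : exists2 K, 0 <= K & forall c (x : N.-tuple R),
  0 < c -> c <= 1 -> sqn x <= a ->
  measurable_fun setT phi -> (forall y, 0 <= phi y) ->
  (((1 - lam * c ^+ 2) * phi x - K * c ^+ 3)%:E <=
    \int[P]_z (phi (tcomb c z x))%:E)%E.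
Proof.
have aa : (0 : R) <= (0 : R) <= a by apply/andP; split => //; exact: ltW.
have M0 : 0 <= M := le_trans (normr_ge0 _) (f2_le aa).
have hd : has_mean P (@dominating R N) (fine (\int[P]_z (dominating z)%:E)).
  split; first exact: integrable_dominating.
  by rewrite fineK//; exact: integrable_fin_num (integrable_dominating P_rect).
move: hd; set G := fine _ => hd.
have K10 : 0 <= K1.
  have A0 : 0 <= 1 + a by lra.
  apply: addr_ge0; first by apply: mulr_ge0; [exact: mulr_ge0|exact: exprn_ge0].
  by apply: divr_ge0 => //; apply: mulr_ge0 => //; lra.
have G0 : 0 <= G.
  rewrite fine_ge0// integral_ge0// => z _; rewrite lee_fin exprn_ge0//.
  by rewrite addr_ge0// sqn_ge0.
exists (K1 * G); first exact: mulr_ge0.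
move=> c x c0 c1 sa mphi phi0.
have hm := has_meanD (has_mean_cst P (f (sqn x)))
 (has_meanD (has_meanZ (2 * c * f1 (sqn x)) (has_mean_dot P_rect x))
  (has_meanD (has_meanZ (c ^+ 2 * f1 (sqn x)) (has_mean_sqn P_rect))
   (has_meanD (has_meanZ (2 * c ^+ 2 * f2 (sqn x)) (has_mean_dot_sqr P_rect x))
    (has_meanZ (- (K1 * c ^+ 3)) hd)))).
have -> : (1 - lam * c ^+ 2) * phi x - K1 * G * c ^+ 3 =
  f (sqn x) + (2 * c * f1 (sqn x) * 0 +
     (c ^+ 2 * f1 (sqn x) * N%:R +
      (2 * c ^+ 2 * f2 (sqn x) * sqn x + - (K1 * c ^+ 3) * G))).
  rewrite /phi sa mulrBl mul1r.
  have -> : lam * c ^+ 2 * f (sqn x) = - (c ^+ 2 * (- lam * f (sqn x))) by ring.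
  by rewrite -ode; ring.
apply: has_mean_le hm _.
- apply/measurable_EFinP; apply: measurableT_comp => //.
  exact: measurable_tcomb.
- by move=> z; rewrite lee_fin.
- by move=> z; rewrite lee_fin; exact: pointwise.
Qed.

End gaussian_step.

(** * The killed walk operator *)

Section killed_kernel.
Context {R : realType} (N : nat).
Variable P : probability (N.-tuple R) R.
Hypothesis P_rect : forall A : 'I_N -> set R, (forall i, measurable (A i)) ->
  P (rect A) = (\prod_(i < N) normal_prob 0 1 (A i))%E.
Variables (c : R) (D : set (N.-tuple R)).
Hypotheses (mD : measurable D).
Local Notation E := (N.-tuple R).
Local Notation leb := (@lebesgue_tuple R N).
Local Open Scope ereal_scope.

Definition heat (u : E -> \bar R) (x : E) : \bar R := \int[P]_z u (tcomb c z x).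

(** One step of the walk, counted only when it starts inside [D]. *)
Definition killed (u : E -> \bar R) (x : E) : \bar R := (\1_D x)%:E * heat u x.

Definition ge0_measurable (u : E -> \bar R) := measurable_fun setT u /\ forall x, 0 <= u x.

Definition supported (u : E -> \bar R) := forall x, (\1_D x)%:E * u x = u x.

Lemma indicEFin_ge0 (x : E) : 0 <= (\1_D x)%:E :> \bar R.
Proof. by rewrite lee_fin. Qed.

Lemma ge0_measurable_indic : ge0_measurable (fun x => (\1_D x)%:E).
Proof.
split; last exact: indicEFin_ge0.
by apply/measurable_EFinP; exact: measurable_indic.
Qed.

Lemma ge0_measurableM u v : ge0_measurable u -> ge0_measurable v -> ge0_measurable (fun x => u x * v x).
Proof.
move=> [mu u0] [mv v0]; split; last by move=> x; rewrite mule_ge0.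
exact: emeasurable_funM.
Qed.

Lemma measurable_shift u : ge0_measurable u ->
  measurable_fun setT (fun xz : E * E => u (tcomb c xz.2 xz.1)).
Proof.
by move=> [mu _]; apply: measurableT_comp => //; exact: measurable_tcomb.
Qed.

Lemma ge0_measurable_heat u : ge0_measurable u -> ge0_measurable (heat u).
Proof.
move=> hu; split; last by move=> x; apply: integral_ge0 => z _; exact: hu.2.
apply: (measurable_fun_fubini_tonelli_F (fun xz : E * E => u (tcomb c xz.2 xz.1))).
- exact: measurable_shift.
- by move=> xz; exact: hu.2.
Qed.

Lemma ge0_measurable_killed u : ge0_measurable u -> ge0_measurable (killed u).
Proof. by move=> hu; apply: ge0_measurableM; [exact: ge0_measurable_indic|exact: ge0_measurable_heat]. Qed.

Lemma indicEFin_idem (x : E) : (\1_D x)%:E * (\1_D x)%:E = (\1_D x)%:E :> \bar R.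
Proof. by rewrite indicE -EFinM -natrM mulnb andbb. Qed.

Lemma supported_killed u : supported (killed u).
Proof. by move=> x; rewrite /killed muleA indicEFin_idem. Qed.

(** Lebesgue measure is invariant under translation by [- c * z] and the
    Gaussian law under [z => - z]. *)
Lemma heat_symmetric u v : ge0_measurable u -> ge0_measurable v ->
  \int[leb]_x (v x * heat u x) = \int[leb]_x (u x * heat v x).
Proof.
move=> hu hv.
have [mu u0] := hu; have [mv v0] := hv.
have mtc z : measurable_fun setT (fun x : E => tcomb c z x).
  by apply: measurable_tcomb => //; exact: measurable_cst.
have mtz x : measurable_fun setT (fun z : E => tcomb c z x).
  by apply: measurable_tcomb => //; exact: measurable_cst.
pose neg := tsign (fun _ : 'I_N => true) : E -> E.
have mneg : measurable_fun setT neg by exact: measurable_tsign.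
transitivity (\int[leb]_x \int[P]_z (v x * u (tcomb c z x))).
  apply: eq_integral => x _; rewrite ge0_integralZl//.
  by apply: measurableT_comp.
have F1 := fubini_tonelli (m1 := leb) (m2 := P) (fun xz : E * E => v xz.1 * u (tcomb c xz.2 xz.1)).
rewrite F1; last 2 first.
- apply: emeasurable_funM; first exact: measurableT_comp.
  exact: measurable_shift.
- by move=> xz; rewrite mule_ge0.
transitivity (\int[P]_z \int[leb]_x (u x * v (tcomb c (neg z) x))).
  apply: eq_integral => z _ /=.
  pose b : E := tcomb c (neg z) (tzero N).
  rewrite (@ge0_integral_lebesgue_tuple_affine R N 1 b)//; last 2 first.
  - by apply: emeasurable_funM => //; exact: measurableT_comp.
  - by move=> x; rewrite mule_ge0.
  rewrite expr1n mul1e; apply: eq_integral => x _; rewrite muleC; congr (u _ * v _).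
    apply: eq_from_tnth => i; rewrite !tnth_mktuple expr1; ring.
  by apply: eq_from_tnth => i; rewrite !tnth_mktuple; ring.
have F2 := fubini_tonelli (m1 := leb) (m2 := P) (fun xz : E * E => u xz.1 * v (tcomb c (neg xz.2) xz.1)).
rewrite -F2; last 2 first.
- apply: emeasurable_funM; first exact: measurableT_comp.
  apply: measurableT_comp => //; apply: measurable_tcomb => //.
  exact: measurableT_comp.
- by move=> xz; rewrite mule_ge0.
apply: eq_integral => x _ /=.
have mvx : measurable_fun setT (fun z : E => v (tcomb c z x)) by exact: measurableT_comp.
rewrite ge0_integralZl//; last exact: (measurableT_comp mvx).
congr (_ * _); rewrite /heat.
transitivity (\int[image_measure P mneg]_z v (tcomb c z x)).
  by rewrite ge0_integral_image_measure.
apply: eq_measure_integral => A mA _.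
exact: (tsign_invariant P_rect (fun=> true) mA).
Qed.

Lemma killed_symmetric u v : ge0_measurable u -> ge0_measurable v -> supported u -> supported v ->
  \int[leb]_x (v x * killed u x) = \int[leb]_x (u x * killed v x).
Proof.
move=> hu hv su sv.
have h w w' : supported w -> \int[leb]_x (w x * killed w' x) = \int[leb]_x (w x * heat w' x).
  by move=> sw; apply: eq_integral => x _; rewrite /killed muleA (muleC (w x) (\1_D x)%:E) sw.
by rewrite !h//; exact: heat_symmetric.
Qed.

Lemma ge0_measurable_iter m u : ge0_measurable u -> ge0_measurable (iter m killed u).
Proof. by move=> hu; elim: m => [//|m IH]; exact: ge0_measurable_killed. Qed.

Lemma supported_iter m u : supported u -> supported (iter m killed u).
Proof. by case: m => [//|m] _; exact: supported_killed. Qed.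

Lemma killed_iter_symmetric m u v : ge0_measurable u -> ge0_measurable v -> supported u -> supported v ->
  \int[leb]_x (v x * iter m killed u x) = \int[leb]_x (u x * iter m killed v x).
Proof.
elim: m u v => [|m IH] u v hu hv su sv.
  by apply: eq_integral => x _; rewrite /= muleC.
rewrite [in LHS]iterSr.
rewrite (IH _ _ (ge0_measurable_killed hu) hv (supported_killed u) sv).
under eq_integral do rewrite muleC.
exact: (killed_symmetric hu (ge0_measurable_iter m hv) su (supported_iter m sv)).
Qed.

Lemma killed_le u v : ge0_measurable u -> ge0_measurable v -> (forall x, u x <= v x) ->
  forall x, killed u x <= killed v x.
Proof.
move=> hu hv uv x; rewrite /killed lee_wpmul2l ?indicEFin_ge0//.
apply: ge0_le_integral => //.
- by move=> z _; exact: hu.2.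
- apply: (measurableT_comp hu.1); apply: measurable_tcomb => //; exact: measurable_cst.
- apply: (measurableT_comp hv.1); apply: measurable_tcomb => //; exact: measurable_cst.
Qed.

Lemma killed_scale (t : R) u : ge0_measurable u -> (0 <= t)%R ->
  forall x, killed (fun y => t%:E * u y) x = t%:E * killed u x.
Proof.
move=> hu t0 x; rewrite /killed muleCA /heat ge0_integralZl//.
- apply: (measurableT_comp hu.1); apply: measurable_tcomb => //; exact: measurable_cst.
- by move=> z _; exact: hu.2.
Qed.

Lemma killed_add_cst (e : R) u : ge0_measurable u -> (0 <= e)%R ->
  forall x, killed (fun y => u y + e%:E) x <= killed u x + e%:E.
Proof.
move=> hu e0 x; rewrite /killed /heat ge0_integralD//; last 2 first.
- by move=> z _; exact: hu.2.
- apply: (measurableT_comp hu.1); apply: measurable_tcomb => //; exact: measurable_cst.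
rewrite integral_cst//= [X in _ + _ * X](_ : _ = 1); last exact: probability_setT.
rewrite mule1 indicE; case: (_ \in _) => /=; first by rewrite !mul1e.
by rewrite !mul0e add0e lee_fin.
Qed.

Lemma killed_le1 m x : iter m killed (fun x => (\1_D x)%:E) x <= 1.
Proof.
have i1 (y : E) : (\1_D y)%:E <= 1 :> \bar R by rewrite lee_fin indicE; case: (_ \in _).
elim: m x => [//|m IH] x /=.
rewrite /killed (@le_trans _ _ (heat (iter m killed (fun x => (\1_D x)%:E)) x))//.
  rewrite -[leRHS]mul1e lee_wpmul2r//.
  exact: (ge0_measurable_heat (ge0_measurable_iter m ge0_measurable_indic)).2.
rewrite /heat (@le_trans _ _ (\int[P]_z cst 1 z))//; last first.
  rewrite integral_cst// mul1e; exact: probability_le1.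
apply: ge0_le_integral => //.
- by move=> z _; exact: (ge0_measurable_iter m ge0_measurable_indic).2.
- apply: (measurableT_comp (ge0_measurable_iter m ge0_measurable_indic).1); apply: measurable_tcomb => //; exact: measurable_cst.
Qed.

Section lower_bound.
Variables (phi : E -> R) (t e : R).
Hypotheses (phi_ok : ge0_measurable (EFin \o phi)) (phi_supp : supported (EFin \o phi)).
Hypotheses (t0 : (0 <= t)%R) (t1 : (t <= 1)%R) (e0 : (0 <= e)%R).
Hypothesis step : forall x, t%:E * (phi x)%:E <= killed (EFin \o phi) x + e%:E.

(** [killed] is positive, homogeneous and does not increase constants, so each
    step costs at most one more [e]. *)
Lemma killed_iter_lower m x :
  (t ^+ m)%:E * (phi x)%:E <= iter m killed (EFin \o phi) x + (m%:R * e)%:E.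
Proof.
elim: m x => [|m IH] x; first by rewrite mul0r expr0 mul1e adde0.
have tm0 : (0 <= t ^+ m)%R by rewrite exprn_ge0.
have tm1 : (t ^+ m <= 1)%R by rewrite exprn_ile1.
have hi := ge0_measurable_iter m phi_ok.
have okt : ge0_measurable (fun y => (t ^+ m)%:E * (EFin \o phi) y).
  split; last by move=> y; apply: mule_ge0; [rewrite lee_fin|exact: phi_ok.2].
  by apply: measurable_funeM; exact: phi_ok.1.
have oka : ge0_measurable (fun y => iter m killed (EFin \o phi) y + (m%:R * e)%:E).
  split; first by apply: emeasurable_funD => //; exact: hi.1.
  by move=> y; rewrite adde_ge0 ?hi.2// lee_fin mulr_ge0.
rewrite exprSr EFinM -muleA.
apply: (@le_trans _ _ ((t ^+ m)%:E * (killed (EFin \o phi) x + e%:E))).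
  by rewrite lee_wpmul2l// lee_fin.
rewrite ge0_muleDr ?(ge0_measurable_killed phi_ok).2 ?lee_fin// -killed_scale//.
apply: (@le_trans _ _ (killed (fun y => iter m killed (EFin \o phi) y + (m%:R * e)%:E) x + e%:E)).
  apply: leeD; first exact: killed_le.
  by rewrite -EFinM lee_fin ler_piMl.
apply: (@le_trans _ _ (killed (iter m killed (EFin \o phi)) x + (m%:R * e)%:E + e%:E)).
  by rewrite leeD2r// killed_add_cst// mulr_ge0.
rewrite -addeA -EFinD iterS; apply: leeD => //.
by rewrite lee_fin -natr1 mulrDl mul1r.
Qed.

Variables (A Q vol : R).
Hypotheses (intA : \int[leb]_x (phi x)%:E = A%:E)
  (intQ : \int[leb]_x (phi x ^+ 2)%:E = Q%:E) (volD : leb D = vol%:E).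

(** Symmetry moves half of the [m + m] steps to the other side, so the left
    integral is that of [w ^+ 2], where [w] is the survival probability for [m]
    steps. The Cauchy-Schwarz inequality is used in the form
    [2 * k * (phi * w) <= w ^+ 2 + k ^+ 2 * phi ^+ 2], with [k] to be optimized
    later. *)
Lemma killed_survival_lower m (k : R) : (0 <= k)%R ->
  (2 * k * (t ^+ m * A - m%:R * e * vol) - k ^+ 2 * Q)%:E <=
  \int[leb]_x iter (m + m) killed (fun x => (\1_D x)%:E) x.
Proof.
move=> k0; set one := fun x : E => (\1_D x)%:E.
have one_ok : ge0_measurable one := ge0_measurable_indic.
have one_supp : supported one by move=> x; exact: indicEFin_idem.
pose w := iter m killed one.
have wok : ge0_measurable w := ge0_measurable_iter m one_ok.
have wsupp : supported w := supported_iter m one_supp.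
have phi0 x : (0 <= phi x)%R by have := phi_ok.2 x; rewrite /= lee_fin.
have mphi2 : measurable_fun setT (fun x => (phi x ^+ 2)%:E).
  by apply/measurable_EFinP; apply: measurable_funX; apply/measurable_EFinP; exact: phi_ok.1.
have -> : \int[leb]_x iter (m + m) killed one x = \int[leb]_x (w x * w x).
  rewrite /w -killed_iter_symmetric// -/w.
  by apply: eq_integral => x _; rewrite iterD -/w (supported_iter m wsupp).
set W := \int[leb]_x (w x * w x).
have Wge0 : 0 <= W by apply: integral_ge0 => x _; rewrite mule_ge0// wok.2.
pose X := \int[leb]_x ((phi x)%:E * w x).
have XE : X = \int[leb]_x (one x * iter m killed (EFin \o phi) x).
  by rewrite /X /w; exact: killed_iter_symmetric.
have young : (2 * k)%:E * X <= W + (k ^+ 2 * Q)%:E.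
  have p2 x : 0 <= (phi x ^+ 2)%:E by rewrite lee_fin exprn_ge0.
  have k2 : 0 <= (k ^+ 2)%:E by rewrite lee_fin exprn_ge0.
  have kk : 0 <= (2 * k)%:E by rewrite lee_fin mulr_ge0.
  have pw x : 0 <= (phi x)%:E * w x by rewrite mule_ge0 ?wok.2// lee_fin.
  have ww x : 0 <= w x * w x by rewrite mule_ge0// wok.2.
  have mpw : measurable_fun setT (fun x => (phi x)%:E * w x).
    by apply: emeasurable_funM; [exact: phi_ok.1|exact: wok.1].
  have mww : measurable_fun setT (fun x => w x * w x).
    by apply: emeasurable_funM; exact: wok.1.
  rewrite [(k ^+ 2 * Q)%:E]EFinM -intQ.
  rewrite -(ge0_integralZl leb measurableT mphi2 (fun x _ => p2 x) k2).
  rewrite /X -(ge0_integralZl leb measurableT mpw (fun x _ => pw x) kk).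
  have kp x : 0 <= (k ^+ 2)%:E * (phi x ^+ 2)%:E by rewrite mule_ge0.
  have mkp : measurable_fun setT (fun x => (k ^+ 2)%:E * (phi x ^+ 2)%:E).
    exact: measurable_funeM.
  rewrite /W -(ge0_integralD leb measurableT (fun x _ => ww x) mww (fun x _ => kp x) mkp).
  apply: ge0_le_integral => //.
  - by move=> x _; rewrite mule_ge0.
  - exact: measurable_funeM.
  - exact: emeasurable_funD.
  move=> x _; have := killed_le1 m x; have := wok.2 x; rewrite -/one -/w.
  case: (w x) => [r||]// r0 r1; rewrite -!EFinM -EFinD lee_fin.
  have := sqr_ge0 (r - k * phi x)%R; rewrite sqrrB mulr2n exprMn.
  by rewrite (expr2 r); set rr := (r * r)%R; set k2p := (k ^+ 2 * _)%R; lra.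
have low : (t ^+ m * A)%:E <= X + (m%:R * e * vol)%:E.
  have ith := ge0_measurable_iter m phi_ok.
  have pE x : 0 <= (phi x)%:E by rewrite lee_fin.
  have tm : 0 <= (t ^+ m)%:E by rewrite lee_fin exprn_ge0.
  have me : 0 <= (m%:R * e)%:E by rewrite lee_fin mulr_ge0.
  have oi x : 0 <= one x * iter m killed (EFin \o phi) x.
    by rewrite mule_ge0 ?one_ok.2 ?ith.2.
  have moi : measurable_fun setT (fun x => one x * iter m killed (EFin \o phi) x).
    by apply: emeasurable_funM; [exact: one_ok.1|exact: ith.1].
  have meo x : 0 <= (m%:R * e)%:E * one x by rewrite mule_ge0 ?one_ok.2.
  have mmeo : measurable_fun setT (fun x => (m%:R * e)%:E * one x).
    by apply: measurable_funeM; exact: one_ok.1.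
  rewrite [(t ^+ m * A)%:E]EFinM -intA.
  rewrite -(ge0_integralZl leb measurableT phi_ok.1 (fun x _ => pE x) tm).
  rewrite XE [(_ * _ * vol)%:E]EFinM -volD -(integral_indicT leb mD).
  rewrite -(ge0_integralZl leb measurableT one_ok.1 (fun x _ => one_ok.2 x) me).
  rewrite -(ge0_integralD leb measurableT (fun x _ => oi x) moi (fun x _ => meo x) mmeo).
  apply: ge0_le_integral => //.
  - by move=> x _; apply: mule_ge0 => //; exact: pE.
  - by apply: measurable_funeM; exact: phi_ok.1.
  - exact: emeasurable_funD.
  move=> x _.
  rewrite -(phi_supp x).
  rewrite muleCA [X in _ + X]muleC -ge0_muleDr ?ith.2 ?lee_fin ?mulr_ge0//.
  by rewrite lee_wpmul2l ?indicEFin_ge0//; exact: killed_iter_lower.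
have Xge0 : 0 <= X by rewrite XE integral_ge0// => x _; rewrite mule_ge0 ?one_ok.2 ?(ge0_measurable_iter m phi_ok).2.
move: young low.
case: W Wge0 => [W||]// _; last by move=> _ _; exact: leey.
case: X Xge0 {XE} => [X||]// X0.
- rewrite -EFinM -EFinD !lee_fin => h1 h2.
  have : (2 * k * (t ^+ m * A) <= 2 * k * (X + m%:R * e * vol))%R.
    by rewrite ler_wpM2l// mulr_ge0.
  lra.
- have [->|kn0] := eqVneq k 0%R.
    by move=> h _; rewrite expr0n/= !mul0r mulr0 mul0r subr0 lee_fin; move: h; rewrite mulr0 expr0n/= mul0r mul0e adde0 lee_fin.
  by rewrite gt0_muley// lte_fin mulr_gt0// lt0r kn0.
Qed.

End lower_bound.

End killed_kernel.

(** * Survival of a random walk *)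

Section survival.
Context {R : realType} (N : nat).
Local Notation E := (N.-tuple R).
Variables (c : R) (D : set E).
Hypothesis mD : measurable D.

(** The sequence lists the steps of the walk, the first one at its head. *)
Fixpoint survive (x : E) (s : seq E) : Prop :=
  D x /\ (if s is z :: s' then survive (tcomb c z x) s' else True).

Definition tuple_cons n (p : E * n.-tuple E) : n.+1.-tuple E :=
  [the n.+1.-tuple E of p.1 :: p.2].

Lemma measurable_tuple_cons n : measurable_fun setT (@tuple_cons n).
Proof. exact: (measurable_cons measurable_fst measurable_snd). Qed.

Lemma measurable_survive n :
  measurable [set p : E * n.-tuple E | survive p.1 p.2].
Proof.
elim: n => [|n IH].
  have -> : [set p : E * 0.-tuple E | survive p.1 p.2] = fst @^-1` D.
    by apply/seteqP; split => -[x t] /=; rewrite (tuple0 t)/=; [move=> []|split].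
  by rewrite -[X in measurable X]setTI; exact: measurable_fst.
pose g (p : E * n.+1.-tuple E) : E * n.-tuple E :=
  (tcomb c (thead p.2) p.1, [tuple of behead p.2]).
have mg : measurable_fun setT g.
  apply/measurable_fun_pair.
    apply: measurable_tcomb => //.
    exact: (measurableT_comp (measurable_tnth ord0)).
  exact: (measurableT_comp (@measurable_behead _ _ n)).
have -> : [set p : E * n.+1.-tuple E | survive p.1 p.2] =
    (fst @^-1` D) `&` (g @^-1` [set p : E * n.-tuple E | survive p.1 p.2]).
  apply/seteqP; split => -[x t] /=; rewrite [in survive x _](tuple_eta t)/=; exact.
apply: measurableI; rewrite -[X in measurable X]setTI.
  exact: measurable_fst.
exact: mg.
Qed.

Variable P : probability E R.
Variable M : forall n, probability (n.-tuple E) R.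
Hypothesis M_rect : forall n (A : 'I_n -> set E),
  (forall i, measurable (A i)) -> M n (rect A) = (\prod_(i < n) P (A i))%E.

Let M_tuple_cons n (S : set (n.+1.-tuple E)) : measurable S ->
  M n.+1 S = (P \x M n)%E (@tuple_cons n @^-1` S).
Proof.
move=> mS.
have MT : (M n.+1 setT < +oo)%E by rewrite probability_setT ltry.
apply: (@tuple_measure_unique _ E n.+1 R (M n.+1)
  (image_measure (P \x M n)%E (@measurable_tuple_cons n)) MT) => // A mA.
change (M n.+1 (rect A) = (P \x M n)%E (@tuple_cons n @^-1` rect A)).
have -> : @tuple_cons n @^-1` rect A = A ord0 `*` rect (fun i => A (lift ord0 i)).
  apply/seteqP; split => -[z t] /=.
    move=> H; split; first by have := H ord0; rewrite tnth0.
    by move=> i; have := H (lift ord0 i); rewrite tnthS.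
  by move=> [H0 H] i; case: (unliftP ord0 i) => [k ->|->]; rewrite ?tnthS ?tnth0.
rewrite product_measure1E//; last by apply: measurable_rect => i; exact: mA.
rewrite (M_rect mA) big_ord_recl; congr (_ * _)%E.
by apply: esym; apply: M_rect => i; exact: mA.
Qed.

(** Decomposition along the first step: the law of [n.+1] independent steps is
    the product of the laws of the first one and of the [n] others. *)
Lemma walk_survival n x :
  M n [set t | survive x t] = iter n (killed P c D) (fun x => (\1_D x)%:E) x.
Proof.
have mS k y : measurable [set t : k.-tuple E | survive y t].
  rewrite -[X in measurable X]setTI.
  exact: (pair1_measurable y measurableT (@measurable_survive k)).
elim: n x => [|n IH] x.
  have [xD|xD] := boolP (x \in D).
    rewrite [X in M 0 X](_ : _ = setT); last first.
      by apply/seteqP; split => t //= _; rewrite (tuple0 t)/=; split => //; rewrite inE in xD.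
    by rewrite /= indicE xD; exact: probability_setT.
  rewrite [X in M 0 X](_ : _ = set0); last first.
    apply/seteqP; split => t //=; rewrite (tuple0 t)/= => -[Dx _].
    by move/negP : xD; apply; rewrite inE.
  by rewrite /= indicE (negbTE xD) measure0.
rewrite M_tuple_cons; last exact: mS.
rewrite [RHS]/= {1}/killed indicE.
have [xD|xD] := boolP (x \in D); last first.
  rewrite mul0e (_ : _ @^-1` _ = set0) ?measure0//.
  by apply/seteqP; split => -[z t] //= [Dx _]; move/negP : xD; apply; rewrite inE.
rewrite mul1e /heat.
transitivity (\int[P]_z M n (xsection (@tuple_cons n @^-1` [set t | survive x t]) z))%E => //.
apply: eq_integral => z _; rewrite -IH; congr (M n _).
apply/seteqP; split => t; rewrite /xsection/= inE/=; first by move=> [].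
by move=> h; split => //; rewrite inE in xD.
Qed.

End survival.

(** * Brownian motion on a time grid *)

Section image_prob.
Context d1 d2 (T1 : measurableType d1) (T2 : measurableType d2) (R : realType).

Definition image_prob (P : probability T1 R) (f : T1 -> T2)
    (mf : measurable_fun setT f) : probability T2 R :=
  distribution P (HB.pack_for {mfun T1 >-> T2} f
    (isMeasurableFun.Build _ _ _ _ f mf)).

Lemma image_probE (P : probability T1 R) (f : T1 -> T2)
    (mf : measurable_fun setT f) A : image_prob P mf A = P (f @^-1` A).
Proof. by []. Qed.

End image_prob.

Section brownian_walk.
Context {R : realType} {d : measure_display} {Om : measurableType d} (N : nat).
Variables (B : R -> Om -> N.-tuple R) (P : N.-tuple R -> probability Om R).
Hypothesis BM : is_brownian_motion B P.
Local Notation E := (N.-tuple R).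

Definition scaled_increment (c s t : R) (w : Om) : E :=
  tcomb c^-1 (increment B s t w) (tzero N).

Lemma tnth_scale (k : R) (z : E) i : tnth (tcomb k z (tzero N)) i = k * tnth z i.
Proof. by rewrite tnth_mktuple [tnth (tzero N) i]tnth_mktuple addr0. Qed.

Lemma measurable_scaled_increment (c s t : R) : 0 <= s -> 0 <= t ->
  measurable_fun setT (scaled_increment c s t).
Proof.
move=> s0 t0; apply: measurable_tcomb => //.
apply/measurable_fun_tnthP => i.
rewrite (_ : _ \o _ = (fun w => tnth (B t w) i - tnth (B s w) i)); last first.
  by apply/funext => w /=; rewrite tnth_mktuple.
by apply: measurable_funB; apply: (measurableT_comp (measurable_tnth i));
  exact: brownian_measurable BM _ _.
Qed.

Lemma scaled_increment_rect x c s t (A : 'I_N -> set R) :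
  0 <= s -> s < t -> c = Num.sqrt (t - s) -> (forall i, measurable (A i)) ->
  P x (scaled_increment c s t @^-1` rect A) = (\prod_(i < N) normal_prob 0 1 (A i))%E.
Proof.
move=> s0 st ce mA; have c0 : 0 < c by rewrite ce sqrtr_gt0 subr_gt0.
have [ind marg] := brownian_gaussian BM x s0 st.
pose A' i : set R := (fun y => c^-1 * y) @^-1` A i.
have mA' i : measurable (A' i).
  rewrite -[X in measurable X]setTI.
  by apply: (@measurable_funM _ (measurableTypeR R) R setT (cst c^-1) id).
have -> : scaled_increment c s t @^-1` rect A =
   \bigcap_(i in setT) ((fun w => tnth (increment B s t w) i) @^-1` A' i).
  apply/seteqP; split => w /= H i.
    by move=> _; have := H i; rewrite tnth_scale.
  by rewrite tnth_scale; exact: H.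
rewrite ind//; apply: eq_bigr => i _; rewrite marg// -ce normal_prob_scale//.
congr (normal_prob 0 1 _); by apply/seteqP; split => y; rewrite /A'/= mulKf// gt_eqF.
Qed.

Let m01 : measurable_fun setT (scaled_increment 1 0 1).
Proof. exact: measurable_scaled_increment. Qed.

(** A standard Gaussian vector, obtained from the process itself. *)
Definition gauss_law : probability E R := image_prob (P (tzero N)) m01.

Lemma gauss_law_rect (A : 'I_N -> set R) : (forall i, measurable (A i)) ->
  gauss_law (rect A) = (\prod_(i < N) normal_prob 0 1 (A i))%E.
Proof.
move=> mA; rewrite /gauss_law image_probE; apply: scaled_increment_rect => //.
by rewrite subr0 sqrtr1.
Qed.

Lemma scaled_increment_law x c s t (A : set E) :
  0 <= s -> s < t -> c = Num.sqrt (t - s) -> measurable A ->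
  P x (scaled_increment c s t @^-1` A) = gauss_law A.
Proof.
move=> s0 st ce mA.
have mi : measurable_fun setT (scaled_increment c s t).
  by apply: measurable_scaled_increment => //; rewrite (le_trans s0)// ltW.
have PT : (image_prob (P x) mi setT < +oo)%E by rewrite probability_setT ltry.
rewrite -(image_probE (P x) mi); apply: tuple_measure_unique PT _ _ mA.
move=> A' mA'; apply: (eq_trans (scaled_increment_rect x s0 st ce mA')).
exact: esym (gauss_law_rect mA').
Qed.

Variables (h c : R).
Hypotheses (h0 : 0 < h) (ce : c = Num.sqrt h).

Let time (k : nat) : R := k%:R * h.
Let Z (k : nat) : Om -> E := scaled_increment c (time k) (time k.+1).

Let time_ge0 k : 0 <= time k. Proof. by rewrite mulr_ge0// ltW. Qed.
Let timeS k : time k.+1 - time k = h.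
Proof. by rewrite /time -natr1; ring. Qed.
Let time_lt k : time k < time k.+1.
Proof. by rewrite -subr_gt0 timeS. Qed.

Definition walk (n : nat) (w : Om) : n.-tuple E := [tuple Z k w | k < n].

Lemma measurable_walk n : measurable_fun setT (walk n).
Proof.
apply/measurable_fun_tnthP => i.
rewrite (_ : _ \o _ = Z i); last by apply/funext => w /=; rewrite tnth_mktuple.
exact: measurable_scaled_increment.
Qed.

(** The normalized increments over the grid are independent and all follow
    [gauss_law]. *)
Lemma walk_rect x n (A : 'I_n -> set E) : (forall i, measurable (A i)) ->
  image_prob (P x) (@measurable_walk n) (rect A) = (\prod_(i < n) gauss_law (A i))%E.
Proof.
move=> mA; rewrite image_probE.
pose A' i : set E := (fun y => tcomb c^-1 y (tzero N)) @^-1` A i.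
have mA' i : measurable (A' i).
  rewrite -[X in measurable X]setTI.
  by apply: (@measurable_tcomb R N _ _ c^-1 id (cst (tzero N))).
have -> : walk n @^-1` rect A =
   \bigcap_(i in [set: 'I_n]) (increment B (time i) (time i.+1) @^-1` A' i).
  apply/seteqP; split => w /= H i.
    by move=> _; have := H i; rewrite tnth_mktuple.
  by rewrite tnth_mktuple; exact: H.
rewrite (brownian_independent BM x (n := n) (t := time))//; last first.
  by move=> k _; exact: ltW.
apply: eq_bigr => i _.
transitivity (P x (Z i @^-1` A i)) => //.
by apply: scaled_increment_law => //; rewrite timeS.
Qed.

Variable D : set E.
Hypothesis mD : measurable D.

Lemma tcomb_scaled_increment k w : tcomb c (Z k w) (B (time k) w) = B (time k.+1) w.
Proof.
have c0 : c != 0 by rewrite ce gt_eqF// sqrtr_gt0.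
apply: eq_from_tnth => i; rewrite tnth_mktuple tnth_scale tnth_mktuple.
by field.
Qed.

Lemma survive_walk n k w : survive c D (B (time k) w) [seq Z i w | i <- iota k n] <->
  (forall i, (k <= i <= k + n)%N -> D (B (time i) w)).
Proof.
elim: n k => [|n IH] k /=.
  split; last by move=> H; split => //; apply: (H k); rewrite addn0 leqnn.
  by move=> [Dk _] i; rewrite addn0 -eqn_leq => /eqP <-.
rewrite tcomb_scaled_increment; split.
  move=> [Dk /IH H] i /andP[]; rewrite leq_eqVlt => /predU1P[<-//|ki ikn].
  by apply: H; rewrite ki addSnnS.
move=> H; split; first by apply: H; rewrite leqnn leq_addr.
apply/IH => i /andP[ki ikn]; apply: H; rewrite ltnW//= -addSnnS//.
Qed.

Lemma walk_seq n w : walk n w = [seq Z i w | i <- iota 0 n] :> seq E.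
Proof. by rewrite /= -val_enum_ord -map_comp. Qed.

(** Almost surely the path starts at [x] and is rebuilt on the grid from [x]
    and its increments. *)
Lemma brownian_survival x n :
  P x [set w | forall i, (i <= n)%N -> D (B (i%:R * h) w)] =
  iter n (killed gauss_law c D) (fun y => (\1_D y)%:E) x.
Proof.
rewrite -(walk_survival c mD (fun k (A : 'I_k -> set E) mA => walk_rect x mA)).
rewrite (image_probE (P x) (@measurable_walk n)).
have mB t : 0 <= t -> measurable_fun setT (B t) by exact: brownian_measurable BM _.
pose F := [set w | B 0 w = x].
have mF : measurable F.
  have -> : F = B 0 @^-1` rect (fun i => [set tnth x i]).
    apply/seteqP; split => w /=; first by move=> -> i.
    by move=> H; apply: eq_from_tnth => i; exact: H.
  rewrite -[X in measurable X]setTI; apply: mB => //.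
  by apply: measurable_rect => i; exact: measurable_set1.
have F1 : P x F = 1%E by exact: brownian_start.
have PF A : measurable A -> P x A = P x (A `&` F).
  move=> mA; rewrite (measureDI (P x) mA mF).
  have PC0 : P x (~` F) = 0%E by rewrite probability_setC// F1 subee.
  rewrite [X in (X + _)%E](_ : _ = 0%E) ?add0e//.
  apply/eqP; rewrite eq_le measure_ge0 andbT -PC0 setDE.
  by apply: measureIr => //; exact: measurableC.
have mS0 : measurable [set t : n.-tuple E | survive c D x t].
  rewrite -[X in measurable X]setTI.
  exact: (pair1_measurable x measurableT (@measurable_survive R N c D mD n)).
have mS : measurable (walk n @^-1` [set t | survive c D x t]).
  by rewrite -[X in measurable X]setTI; apply: measurable_walk.
have mA : measurable [set w | forall i, (i <= n)%N -> D (B (i%:R * h) w)].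
  have -> : [set w | forall i, (i <= n)%N -> D (B (i%:R * h) w)] =
     \bigcap_(i in [set i | (i <= n)%N]) (B (i%:R * h) @^-1` D).
    by apply/seteqP; split => w /= H i; exact: H.
  apply: bigcap_measurable => [|i _]; first by exists 0%N.
  by rewrite -[X in measurable X]setTI; apply: mB => //; exact: time_ge0.
apply: (eq_trans (PF _ mA)); apply: esym; apply: (eq_trans (PF _ mS)); apply: esym.
congr (P x _).
apply/seteqP; split => w /= [H Fw]; split=> //.
  rewrite walk_seq -[in survive _ _ x]Fw.
  have -> : B 0 w = B (time 0) w by rewrite /time mul0r.
  by apply/survive_walk => i /andP[_ ik]; exact: H.
move=> i ik; move: H; rewrite walk_seq -[in survive _ _ x]Fw.
have -> : B 0 w = B (time 0) w by rewrite /time mul0r.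
by move/survive_walk; apply.
Qed.

End brownian_walk.

(** * From grid confinement to the running maximum *)

Lemma cvgr_sum (R : realType) (T : Type) (F : set_system T) {FF : Filter F}
    (I : Type) (r : seq I) (f : I -> T -> R) (l : I -> R) :
  (forall i, f i t @[t --> F] --> l i) ->
  (\sum_(i <- r) f i t) @[t --> F] --> \sum_(i <- r) l i.
Proof.
move=> h; elim: r => [|i r IH].
  have -> : (fun t => \sum_(i <- [::]) f i t) = cst 0.
    by apply/funext => t; rewrite big_nil.
  by rewrite big_nil; exact: cvg_cst.
have -> : (fun t => \sum_(k <- i :: r) f k t) = (fun t => f i t + \sum_(k <- r) f k t).
  by apply/funext => t; rewrite big_cons.
by rewrite big_cons; exact: (cvgD (h i) IH).
Qed.

Section confinement.
Context {R : realType} {d : measure_display} {Om : measurableType d} (N : nat).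
Variables (B : R -> Om -> N.-tuple R) (P : N.-tuple R -> probability Om R).
Hypothesis BM : is_brownian_motion B P.
Variable T : R.
Hypothesis T0 : 0 < T.

Definition confined (a : R) : set Om :=
  [set w | forall t, t \in `[0, T] -> sqn (B t w) <= a].

(** The number of steps is written [m + m] to match [killed_survival_lower]. *)
Definition mesh (k : nat) : R := T / (2 ^ k + 2 ^ k)%:R.

Definition grid_confined (a : R) (k : nat) : set Om :=
  [set w | forall i, (i <= 2 ^ k + 2 ^ k)%N -> sqn (B (i%:R * mesh k) w) <= a].

Let grid_pos k : (0 < 2 ^ k + 2 ^ k)%N.
Proof. by rewrite addn_gt0 expn_gt0. Qed.

Lemma mesh_gt0 k : 0 < mesh k.
Proof. by rewrite divr_gt0// ltr0n. Qed.

Lemma mesh_cvg0 : mesh k @[k --> \oo] --> 0.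
Proof.
rewrite -[X in _ --> X](mulr0 T); apply: cvgM; first exact: cvg_cst.
apply: (squeeze_cvgr _ (cvg_cst 0) (@cvg_harmonic R)).
apply: nearW => k; rewrite invr_ge0 ler0n/= lef_pV2 ?posrE ?ltr0n//.
rewrite ler_nat (leq_trans _ (leq_addr _ _))//.
exact: ltn_expl.
Qed.

Lemma continuous_sqn_path w : {within `[0, +oo[, continuous (fun t => sqn (B t w))}.
Proof.
move=> t; have FF : Filter (nbhs (t : subspace (`[0, +oo[%classic : set R))).
  exact: nbhs_filter.
apply: (@cvgr_sum R _ _ FF _ _ (fun i t => tnth (B t w) i ^+ 2)) => i.
have h := @brownian_continuous R d Om N B P BM w i t; exact: (cvgM h h).
Qed.

(** Dyadic times are dense in [[0, T]] and the paths are continuous. *)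
Lemma confined_grid a : confined a = \bigcap_k grid_confined a k.
Proof.
apply/seteqP; split => w H.
  move=> k _ i ik; apply: H; rewrite in_itv/=; apply/andP; split.
    by apply: mulr_ge0 => //; exact: ltW (mesh_gt0 k).
  by rewrite /mesh mulrCA ger_pMr// ler_pdivrMr ?ltr0n// mul1r ler_nat.
move=> s; rewrite in_itv/= => /andP[s0 sT]; rewrite leNgt; apply/negP => a_lt.
have s0' : `[0, +oo[%classic s by rewrite /= in_itv/= andbT.
have : within `[0, +oo[ (nbhs s) [set t | a < sqn (B t w)].
  by rewrite (nbhs_subspace_in s0'); exact: cvgr_gt (@continuous_sqn_path w s) _ a_lt.
move=> /nbhs_ballP[e /= e0 He].
have [k mk] : exists k, mesh k < e.
  have /cvgrPdist_lt/(_ e e0) := mesh_cvg0.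
  move=> -[k _ /(_ k (leqnn k))]; rewrite /= sub0r normrN gtr0_norm ?mesh_gt0// => mk.
  by exists k.
pose i := Num.truncn (s / mesh k).
have sm0 : 0 <= s / mesh k by rewrite divr_ge0// ltW// mesh_gt0.
have /andP[i1 i2] := truncn_itv sm0.
have iks : i%:R * mesh k <= s by rewrite -ler_pdivlMr// mesh_gt0.
have si : s < i%:R * mesh k + mesh k.
  by rewrite -[X in _ + X]mul1r -mulrDl natr1 -ltr_pdivrMr// mesh_gt0.
have iN : (i <= 2 ^ k + 2 ^ k)%N.
  rewrite -(ler_nat R) (le_trans i1)// ler_pdivrMr ?mesh_gt0//.
  by rewrite /mesh mulrCA divff ?mulr1// pnatr_eq0 -lt0n.
have := H k I i iN; rewrite leNgt => /negP; apply.
apply: He; last by rewrite /= in_itv/= andbT mulr_ge0// ltW// mesh_gt0.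
by rewrite /ball/= ger0_norm; lra.
Qed.

Lemma grid_confined_nonincreasing a : nonincreasing_seq (grid_confined a).
Proof.
apply/nonincreasing_seqP => k; rewrite subsetEset => w H i ik.
have -> : i%:R * mesh k = (i * 2)%:R * mesh k.+1.
  have M0 : (2 ^ k + 2 ^ k)%:R != 0 :> R by rewrite pnatr_eq0 -lt0n.
  rewrite /mesh !expnS -mulnDr natrM [(2 * _)%:R]natrM.
  by move: M0; set M := _%:R => M0; field.
by apply: H; rewrite !expnS -mulnDr mulnC leq_mul2l.
Qed.

Lemma measurable_sqn_process t a : 0 <= t -> measurable [set w | sqn (B t w) <= a].
Proof.
move=> t0; apply: measurable_ler_set => //.
exact: (measurableT_comp (@measurable_sqn R N) (brownian_measurable BM t0)).
Qed.

Lemma measurable_grid_confined a k : measurable (grid_confined a k).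
Proof.
have -> : grid_confined a k = \bigcap_(i in [set i | (i <= 2 ^ k + 2 ^ k)%N])
    [set w | sqn (B (i%:R * mesh k) w) <= a].
  by apply/seteqP; split => w /= H i; exact: H.
apply: bigcap_measurable => [|i _]; first by exists 0%N.
by apply: measurable_sqn_process; rewrite mulr_ge0// ltW// mesh_gt0.
Qed.

Lemma measurable_confined a : measurable (confined a).
Proof.
rewrite confined_grid; apply: bigcapT_measurable => k.
exact: measurable_grid_confined.
Qed.

Definition threshold (j : nat) : R := 1 - j.+2%:R^-1.

Lemma threshold_gt0 j : 0 < threshold j.
Proof. by rewrite subr_gt0 invf_lt1// ltr1n. Qed.

Lemma threshold_lt1 j : threshold j < 1.
Proof. by rewrite ltrBlDr ltrDl invr_gt0. Qed.

Lemma threshold_cvg1 : threshold j @[j --> \oo] --> (1 : R).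
Proof.
rewrite -[X in _ --> X]subr0; apply: cvgB; first exact: cvg_cst.
have := @cvg_harmonic R; rewrite -cvg_shiftS; exact.
Qed.

Lemma enorm_sqn (x : N.-tuple R) : enorm x = Num.sqrt (sqn x).
Proof. by []. Qed.

(** The supremum of an unbounded set is [0], so the left event is only
    meaningful because the path attains its maximum. *)
Lemma running_max_lt1E :
  [set w | running_max B T w < 1] = \bigcup_j confined (threshold j).
Proof.
apply/seteqP; split => w.
  move=> /= m1.
  (* boundedness of the path on [[0, T]], without which the supremum would be [0] *)
  have c0T : {within `[0, T], continuous (fun t => sqn (B t w))}.
    apply: continuous_subspaceW (@continuous_sqn_path w) => t /=.
    by rewrite !in_itv/= andbT => /andP[].
  have [m mT mmax] := EVT_max (ltW T0) c0T.
  have qm : sqn (B m w) < 1.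
    suff : enorm (B m w) < 1.
      by rewrite enorm_sqn -{1}sqrtr1 ltr_sqrt.
    apply: le_lt_trans m1; rewrite /running_max; apply: ub_le_sup; last by exists m.
    exists (enorm (B m w)) => _ [t tT <-].
    by rewrite !enorm_sqn ler_wsqrtr// mmax.
  have [j hj] : exists j : nat, sqn (B m w) <= threshold j.
    have /cvgrPdist_lt/(_ (1 - sqn (B m w))) := threshold_cvg1.
    rewrite subr_gt0 => /(_ qm) [j _ /(_ j (leqnn j))] /= hj; exists j.
    move: hj; rewrite gtr0_norm ?subr_gt0 ?threshold_lt1//; lra.
  by exists j => // t tT; rewrite (le_trans _ hj)// mmax.
move=> [j _ H]; rewrite /= (@le_lt_trans _ _ (Num.sqrt (threshold j)))//; last first.
  by rewrite -[ltRHS]sqrtr1 ltr_sqrt// threshold_lt1.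
apply: ge_sup.
  by exists (enorm (B 0 w)); exists 0 => //=; rewrite in_itv/= lexx ltW.
move=> _ [t tT <-]; rewrite enorm_sqn ler_wsqrtr// H//.
Qed.

Lemma confined_nondecreasing : nondecreasing_seq (fun j => confined (threshold j)).
Proof.
apply/nondecreasing_seqP => j; rewrite subsetEset => w H t tT.
rewrite (le_trans (H t tT))// lerD2l lerN2 lef_pV2 ?posrE// ler_nat.
by [].
Qed.

Lemma measurable_running_max_lt1 : measurable [set w | running_max B T w < 1].
Proof.
by rewrite running_max_lt1E; apply: bigcupT_measurable => j; exact: measurable_confined.
Qed.

Lemma grid_confined_survival a k x :
  P x (grid_confined a k) = iter (2 ^ k + 2 ^ k)
    (killed (gauss_law BM) (Num.sqrt (mesh k)) [set y | sqn y <= a])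
    (fun y => (\1_[set y : N.-tuple R | sqn y <= a] y)%:E) x.
Proof.
rewrite -(brownian_survival BM (mesh_gt0 k) erefl)//.
by apply: measurable_ler_set => //; exact: measurable_sqn.
Qed.

End confinement.

(** * The lower bound on smaller balls *)

Section eigenfunction.
Context {R : realType} (N : nat).
Hypothesis N0 : (0 < N)%N.

(** The profile [z => profile 0 z] is rescaled so that its first zero falls on
    [a]; one more derivative gives the Lipschitz constant of [f2]. *)
Lemma scaled_profile (a j : R) : 0 < a ->
  is_first_positive_zero (besselJ ((N%:R - 2) / 2)) j ->
  exists f f1 f2 : R -> R, exists2 L, 0 <= L &
  [/\ forall s : R, is_derive s 1 f (f1 s),
      forall s : R, is_derive s 1 f1 (f2 s),
      forall s, 2 * s * f2 s + N%:R * f1 s = - (j ^+ 2 / (2 * a)) * f s,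
      forall s t, 0 <= s <= a -> 0 <= t <= a -> `|f2 s - f2 t| <= L * `|s - t| &
      (forall s, 0 <= s < a -> 0 < f s) /\ f a = 0].
Proof.
move=> a0 /(profile_first_zero N0)[j0 gj gpos].
pose ka := j ^+ 2 / a.
have j20 : 0 < j ^+ 2 by rewrite exprn_gt0.
have ka0 : 0 < ka by rewrite divr_gt0.
have kaa : ka * a = j ^+ 2 by rewrite divfK// gt_eqF.
pose g i s : R := ka ^+ i * profile N i (ka * s).
have dg i (s : R) : is_derive s 1 (g i) (g i.+1 s).
  have dk : is_derive s 1 (fun s : R => ka * s) ka.
    by apply: is_derive_eq; rewrite /GRing.scale/=; ring.
  have dc := @is_derive1_comp R (profile N i) (fun s => ka * s) s _ _
    (is_derive_profile N0 i _) dk.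
  have := is_deriveZ (ka ^+ i) dc; rewrite /GRing.scale/= => /is_derive_eq; apply.
  by rewrite /g exprSr; ring.
have cg i : continuous (g i) by move=> s; exact: is_derive_cvg (dg i s).
have cn : {within `[0, a], continuous (fun s => `|g 3 s|)}.
  by apply: continuous_subspaceT => s; apply: cvg_norm; exact: cg.
have [m ma mmax] := EVT_max (ltW a0) cn.
exists (g 0), (g 1), (g 2), `|g 3 m| => //; split.
- exact: dg.
- exact: dg.
- move=> s; have := profile_ode N0 (ka * s) => h.
  have -> : j ^+ 2 / (2 * a) = ka / 2 by rewrite /ka; field; rewrite gt_eqF.
  rewrite /g expr0 expr1 mul1r.
  have -> : profile N 0 (ka * s) = - (4 * (ka * s) * profile N 2 (ka * s) +
      2 * N%:R * profile N 1 (ka * s)) by lra.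
  by field.
- move=> s t sa ta; have [c hc ->] := MVT_between t s (dg 2).
  rewrite normrM ler_wpM2r//; apply: mmax; rewrite in_itv/=.
  move: sa ta hc => /andP[s0 sa] /andP[t0 ta].
  by have [ts|st] := leP t s => /andP[h1 h2]; apply/andP; split; lra.
- rewrite /g expr0; split; last by rewrite kaa gj mulr0.
  move=> s /andP[s0 sa]; rewrite mul1r gpos// mulr_ge0 ?(ltW ka0)//=.
  by rewrite -kaa ltr_pM2l.
Qed.

End eigenfunction.

Lemma expRN_le_quadratic (R : realType) (y : R) : 0 <= y ->
  expR (- y) <= 1 - y + y ^+ 2.
Proof.
move=> y0; rewrite expRN.
have e0 := expR_gt0 y.
rewrite -[leLHS]mul1r ler_pdivrMr//.
have h := expR_ge1Dx y.
have q0 : 0 <= 1 - y + y ^+ 2.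
  have := sqr_ge0 (y - 1 / 2); rewrite sqrrB mulr2n; lra.
apply: (@le_trans _ _ ((1 - y + y ^+ 2) * (1 + y))); last by rewrite ler_wpM2l.
have y3 : 0 <= y ^+ 3 by rewrite exprn_ge0.
have -> : (1 - y + y ^+ 2) * (1 + y) = 1 + y ^+ 3 by ring.
by rewrite lerDl.
Qed.

Section confined_lower_bound.
Context {R : realType} {d : measure_display} {Om : measurableType d} (N : nat).
Variables (B : R -> Om -> N.-tuple R) (P : N.-tuple R -> probability Om R).
Hypothesis BM : is_brownian_motion B P.
Variables (T a j : R).
Hypotheses (N0 : (0 < N)%N) (T0 : 0 < T) (a0 : 0 < a) (a1 : a < 1).
Hypothesis j_zero : is_first_positive_zero (besselJ ((N%:R - 2) / 2)) j.
Local Notation E := (N.-tuple R).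
Local Notation leb := (@lebesgue_tuple R N).
Local Notation n := (N%:R / 2 : R).

Let D : set E := [set y | sqn y <= a].
Let mD : measurable D.
Proof. by apply: measurable_ler_set => //; exact: measurable_sqn. Qed.

Lemma open_unit_ballE : open_unit_ball N = [set x : E | sqn x < 1].
Proof.
have h (x : E) : (enorm x < 1) = (sqn x < 1).
  by rewrite enorm_sqn -[X in _ < X]sqrtr1 ltr_sqrt.
by apply/seteqP; split => x; rewrite /open_unit_ball/= h.
Qed.

Lemma measurable_open_unit_ball : measurable (open_unit_ball N : set E).
Proof. by rewrite open_unit_ballE; exact: measurable_sqn_lt. Qed.

Lemma open_unit_ball_lty : (leb (open_unit_ball N) < +oo)%E.
Proof.
rewrite open_unit_ballE -/(unit_ball_vol N) unit_ball_vol_sphere_area//.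
exact: ltry.
Qed.

Let DU : D `<=` open_unit_ball N.
Proof. by rewrite open_unit_ballE => x Dx; exact: le_lt_trans a1. Qed.

Let v k (x : E) : \bar R := iter (2 ^ k + 2 ^ k)
  (killed (gauss_law BM) (Num.sqrt (mesh T k)) D) (fun y => (\1_D y)%:E) x.

Let vE k x : P x (grid_confined B T a k) = v k x.
Proof. exact: grid_confined_survival. Qed.

Let v_ok k : ge0_measurable (v k).
Proof. by apply: ge0_measurable_iter => //; exact: ge0_measurable_indic. Qed.

Let integral_v k :
  (\int[leb]_(x in open_unit_ball N) v k x = \int[leb]_x v k x)%E.
Proof.
rewrite integral_mkcond; apply: eq_integral => x _; rewrite patchE.
case: ifPn => // /negP xU; apply/esym.
have supp := @supported_iter R N (gauss_law BM) (Num.sqrt (mesh T k)) D (2 ^ k + 2 ^ k)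
  (fun y => (\1_D y)%:E) (fun x => indicEFin_idem D x).
have := supp x; rewrite -/(v k x) => <-.
by rewrite indicE memNset ?mul0e// => Dx; apply: xU; rewrite inE; exact: DU.
Qed.

Lemma grid_survival_cvg x : v ^~ x @ \oo --> P x (confined B T a).
Proof.
rewrite (confined_grid BM T0).
under eq_fun do rewrite -vE.
apply: nonincreasing_cvg_mu.
- apply: le_lt_trans (ltry 1); apply: probability_le1.
  exact: (measurable_grid_confined BM T0).
- by move=> k; exact: (measurable_grid_confined BM T0).
- by apply: bigcapT_measurable => k; exact: (measurable_grid_confined BM T0).
- exact: (grid_confined_nonincreasing B T a).
Qed.

Lemma measurable_prob_confined :
  measurable_fun setT (fun x => P x (confined B T a)).
Proof.
apply: (emeasurable_fun_cvg v) => [k|x _]; first exact: (v_ok k).1.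
exact: grid_survival_cvg.
Qed.

Lemma confined_cvg :
  (\int[leb]_x v k x)%E @[k --> \oo] -->
  (\int[leb]_(x in open_unit_ball N) P x (confined B T a))%E.
Proof.
under eq_fun do rewrite -integral_v.
have mU := measurable_open_unit_ball.
have mv k : measurable_fun (open_unit_ball N) (v k).
  by apply: measurable_funTS; exact: (v_ok k).1.
have mlim : measurable_fun (open_unit_ball N) (fun x => P x (confined B T a)).
  by apply: measurable_funTS; exact: measurable_prob_confined.
have icst : leb.-integrable (open_unit_ball N) (cst 1%E).
  apply/integrableP; split; first exact: measurable_cst.
  rewrite (eq_integral (cst 1%E)) => [|x _]; last by rewrite /= normr1.
  by rewrite integral_cst// mul1e open_unit_ball_lty.
have dom : {ae leb, forall x k, (open_unit_ball N : set E) x -> (`|v k x| <= cst 1 x)%E}.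
  apply: aeW => x k _; rewrite gee0_abs ?(v_ok k).2// -vE.
  by apply: probability_le1; exact: (measurable_grid_confined BM T0).
have aecvg : {ae leb, forall x, (open_unit_ball N : set E) x ->
    v ^~ x @ \oo --> P x (confined B T a)}.
  by apply: aeW => x _; exact: grid_survival_cvg.
have [_ _ h] := dominated_convergence mU mv mlim aecvg icst dom.
exact: h.
Qed.

(** The bound for [m + m] steps of variance [c ^+ 2 = T / (m + m)], passed to the
    limit. One step multiplies [phi] by at least [expR (- (lam * c ^+ 2))] up to
    an error of order [c ^+ 3]; the [m] steps add up to the exact factor [q] and
    to an error [err k] that vanishes. The values of the integrals of [phi] and
    of its square then give the constant. *)
Lemma confined_lower_bound :
  ((2 * sphere_area N / j ^+ 2 * (a `^ n * expR (- (j ^+ 2 / (2 * a)) * T)))%:E <=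
   \int[leb]_(x in open_unit_ball N) P x (confined B T a))%E.
Proof.
have [f [f1 [f2 [L L0 [df df1 ode lip [fpos fa]]]]]] := scaled_profile N0 a0 j_zero.
have j0 : 0 < j by case: j_zero.
set lam := j ^+ 2 / (2 * a) in ode *.
have lam0 : 0 < lam by rewrite divr_gt0 ?exprn_gt0// mulr_gt0.
have aa : 0 <= a <= a by rewrite lexx ltW.
have [C C0 taylor] := profile_taylor_positive_part N0 a0 lam0 L0 df df1 ode lip fpos fa.
have f2_le s : 0 <= s <= a -> `|f2 s| <= `|f2 a| + L * a.
  move=> /[dup] sa /andP[s0 sa1]; rewrite -[f2 s](subrK (f2 a)) addrC.
  rewrite (le_trans (ler_normD _ _))// lerD2l (le_trans (lip _ _ sa aa))//.
  by rewrite ler_wpM2l// distrC ger0_norm; lra.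
have [K K0 step] := gaussian_step (gauss_law_rect BM) a0 C0 ode f2_le taylor.
pose phi (y : E) : R := if sqn y <= a then f (sqn y) else 0.
have fge0 s : 0 <= s <= a -> 0 <= f s.
  move=> /andP[s0]; rewrite le_eqVlt => /predU1P[->|sa]; first by rewrite fa.
  by rewrite ltW// fpos// s0.
have phi0 y : 0 <= phi y.
  by rewrite /phi; case: ifP => // sa; rewrite fge0// sqn_ge0.
have mphi : measurable_fun setT phi.
  apply: measurable_fun_ifT.
  - by apply: measurable_fun_ler => //; exact: measurable_sqn.
  - apply: measurableT_comp; last exact: measurable_sqn.
    by apply: continuous_measurable_fun => s; exact: is_derive_cvg (df s).
  - exact: measurable_cst.
have cf : {within `[0, a], continuous f}.
  by apply: continuous_subspaceT => s; exact: is_derive_cvg (df s).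
have [m ma mmax] := EVT_max (ltW a0) cf.
set F := f m in mmax.
have F0 : 0 <= F by rewrite fge0//; move: ma; rewrite in_itv/=.
have phiF y : phi y <= F.
  by rewrite /phi; case: ifP => // sa; apply: mmax; rewrite in_itv/= sqn_ge0.
have phi_ok : ge0_measurable (EFin \o phi).
  by split; [exact/measurable_EFinP|move=> y; rewrite lee_fin].
have phi_supp : supported D (EFin \o phi).
  move=> y; rewrite /= indicE /phi /D; case: ifPn => sa.
    by rewrite mem_set//= mul1e.
  by rewrite mule0.
have V0 := @unit_ball_vol_sphere_area R N N0.
set V := sphere_area N / N%:R in V0.
pose be := - f1 a.
have be0 : 0 < be.
  by rewrite oppr_gt0 (profile_slope_lt0 N0 a0 lam0 df1 ode fpos).
pose A := V * (a `^ n * (N%:R / lam * be)).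
pose Q := V * (a `^ n * (N%:R / lam * (a * be ^+ 2))).
have intA : (\int[leb]_x (phi x)%:E = A%:E)%E.
  rewrite /A EFinM -V0 -(integral_profile N0 a0 lam0 df df1 ode fpos fa).
  rewrite [RHS]integral_mkcond; apply: eq_integral => x _.
  rewrite patchE /phi; case: ifPn => sa; first by rewrite mem_set.
  by rewrite memNset//; exact/negP.
have intQ : (\int[leb]_x (phi x ^+ 2)%:E = Q%:E)%E.
  rewrite /Q /be sqrrN EFinM -V0 -(integral_profile_sqr N0 a0 lam0 df df1 ode fpos fa).
  rewrite [RHS]integral_mkcond; apply: eq_integral => x _.
  rewrite patchE /phi; case: ifPn => sa; first by rewrite mem_set.
  by rewrite memNset ?expr0n//; exact/negP.
pose vol := fine (leb D).
have volD : leb D = vol%:E.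
  rewrite fineK// ge0_fin_numE//; apply: le_lt_trans open_unit_ball_lty.
  by apply: le_measure; rewrite ?inE//; exact: measurable_open_unit_ball.
have vol0 : 0 <= vol by rewrite fine_ge0.
have Vpos : 0 < V.
  have [V' V'E [V'0 _]] := @unit_ball_vol_Gamma R N.
  by move: V'E; rewrite V0 => -[->].
have NR0 : 0 < N%:R :> R by rewrite ltr0n.
have an0 : 0 < a `^ n by rewrite powR_gt0.
have Nlam0 : 0 < N%:R / lam by exact: divr_gt0.
have A0 : 0 < A.
  by do 2 (apply: mulr_gt0 => //); exact: mulr_gt0.
have Q0 : 0 < Q.
  do 2 (apply: mulr_gt0 => //); apply: mulr_gt0 => //.
  by apply: mulr_gt0 => //; exact: exprn_gt0.
pose q := expR (- lam * (T / 2)).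
(* the value of [k] that maximizes [2 * k * (q * A) - k ^+ 2 * Q] *)
pose kap := q * A / Q.
have kap0 : 0 <= kap by rewrite divr_ge0// ?(ltW Q0)// mulr_ge0 ?expR_ge0 ?(ltW A0).
pose err k := T / 2 * (K * Num.sqrt (mesh T k) + lam ^+ 2 * F * mesh T k).
pose r k := 2 * kap * (q * A - err k * vol) - kap ^+ 2 * Q.
have r_cvg : r k @[k --> \oo] --> 2 * kap * (q * A - 0 * vol) - kap ^+ 2 * Q.
  apply: cvgB; last exact: cvg_cst.
  apply: cvgM; first exact: cvg_cst.
  apply: cvgB; first exact: cvg_cst.
  apply: cvgM; last exact: cvg_cst.
  rewrite -[X in _ --> X](mulr0 (T / 2)); apply: cvgM; first exact: cvg_cst.
  rewrite -[X in _ --> X](addr0 0); apply: cvgD.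
    rewrite -[X in _ --> X](mulr0 K); apply: cvgM; first exact: cvg_cst.
    have : Num.sqrt (mesh T k) @[k --> \oo] --> Num.sqrt (0 : R).
      by apply: continuous_cvg; [exact: sqrt_continuous|exact: mesh_cvg0].
    by rewrite sqrtr0.
  rewrite -[X in _ --> X](mulr0 (lam ^+ 2 * F)); apply: cvgM; first exact: cvg_cst.
  exact: mesh_cvg0.
have r_lim : 2 * kap * (q * A - 0 * vol) - kap ^+ 2 * Q =
    2 * sphere_area N / j ^+ 2 * (a `^ n * expR (- lam * T)).
  have -> : expR (- lam * T) = q ^+ 2.
    by rewrite /q expr2 -expRD; congr expR; field.
  have -> : sphere_area N = N%:R * V by rewrite /V mulrC divfK// gt_eqF.
  have -> : j ^+ 2 = 2 * a * lam by rewrite /lam mulrC divfK// gt_eqF// mulr_gt0.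
  rewrite /kap /Q /A; field.
  by rewrite !gt_eqF.
rewrite -r_lim.
have rE : (r k)%:E @[k --> \oo] --> (2 * kap * (q * A - 0 * vol) - kap ^+ 2 * Q)%:E.
  by apply: cvg_EFin => //; exact: nearW.
rewrite -(cvg_lim _ rE)// -(cvg_lim _ confined_cvg)//.
apply: lee_lim.
- by apply/cvg_ex; exists (2 * kap * (q * A - 0 * vol) - kap ^+ 2 * Q)%:E.
- by apply/cvg_ex; eexists; exact: confined_cvg.
near=> k.
pose c := Num.sqrt (mesh T k).
have mk0 : 0 < mesh T k by exact: mesh_gt0.
have mk1 : mesh T k <= 1.
  near: k; have /cvgrPdist_le/(_ 1 ltr01) := mesh_cvg0 T.
  by apply: filterS => k; rewrite sub0r normrN; apply: le_trans; exact: ler_norm.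
have c0 : 0 < c by rewrite sqrtr_gt0.
have c1 : c <= 1 by rewrite -sqrtr1 ler_wsqrtr.
have c2 : c ^+ 2 = mesh T k by rewrite sqr_sqrtr// ltW.
pose t := expR (- (lam * c ^+ 2)).
pose e := K * c ^+ 3 + (lam * c ^+ 2) ^+ 2 * F.
have y0 : 0 <= lam * c ^+ 2 by rewrite mulr_ge0 ?(ltW lam0)// exprn_ge0// ltW.
have e0 : 0 <= e by rewrite addr_ge0// mulr_ge0// exprn_ge0// ltW.
have t0 : 0 <= t by exact: expR_ge0.
have t1 : t <= 1 by rewrite -expR0 ler_expR oppr_le0.
have kstep x : (t%:E * (phi x)%:E <= killed (gauss_law BM) c D (EFin \o phi) x + e%:E)%E.
  rewrite /killed indicE; case: (boolP (sqn x <= a)) => sa; last first.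
    rewrite memNset/=; last exact/negP.
    by rewrite /phi (negbTE sa) mule0 mul0e add0e lee_fin.
  rewrite mem_set//= mul1e /heat.
  have := step c x c0 c1 sa mphi phi0.
  move=> /(leeD2r e%:E); apply: le_trans.
  rewrite -EFinD -EFinM lee_fin.
  have h1 : t * phi x <= (1 - lam * c ^+ 2 + (lam * c ^+ 2) ^+ 2) * phi x.
    by rewrite ler_wpM2r// expRN_le_quadratic.
  have h2 : (lam * c ^+ 2) ^+ 2 * phi x <= (lam * c ^+ 2) ^+ 2 * F.
    by rewrite ler_wpM2l// exprn_ge0.
  by rewrite /e -/(phi x); lra.
have := killed_survival_lower (gauss_law_rect BM) mD phi_ok phi_supp t0 t1 e0 kstep
  intA intQ volD (2 ^ k) kap0.
apply: le_trans; rewrite lee_fin.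
have p2 : (2 ^ k)%:R * mesh T k = T / 2.
  rewrite /mesh natrD; have : (2 ^ k)%:R != 0 :> R by rewrite pnatr_eq0 -lt0n expn_gt0.
  by move=> ?; field.
have -> : t ^+ (2 ^ k) = q.
  rewrite /t /q -expRM_natl c2; congr expR.
  by rewrite -p2; ring.
have -> : (2 ^ k)%:R * e = err k.
  rewrite /err -p2 /e -c2 -/c; have -> : Num.sqrt (c ^+ 2) = c.
    by rewrite sqrtr_sqr gtr0_norm.
  ring.
exact: lexx.
Unshelve. all: by end_near. Qed.

End confined_lower_bound.

Theorem lemma1p1 (R : realType) (d : measure_display) (Om : measurableType d)
    (N : nat) (B : R -> Om -> N.-tuple R)
    (P : N.-tuple R -> probability Om R) (T : R) :
  (1 <= N)%N -> is_brownian_motion B P -> 0 < T ->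
  ((2 * sphere_area N / besselJ_zero1 ((N%:R - 2) / 2) ^+ 2
      * expR (- (1 / 2) * besselJ_zero1 ((N%:R - 2) / 2) ^+ 2 * T))%:E
   <= \int[lebesgue_tuple N]_(xi in open_unit_ball N)
        P xi [set w | (running_max B T w < 1)%R])%E.
Proof.
move=> N0 BM T0; rewrite /besselJ_zero1.
have [ex|nex] := pselect (exists j : R,
  is_first_positive_zero (besselJ ((N%:R - 2) / 2)) j); last first.
  (* without a positive zero, [besselJ_zero1] is [0] and so is the left side,
     division by [0] giving [0] *)
  rewrite xgetPN; last by move=> j hj; apply: nex; exists j.
  rewrite expr0n/= invr0 mulr0 mul0r.
  by apply: integral_ge0 => x _; exact: measure_ge0.
have := xgetPex 0 ex; set j := xget _ _ => j_zero.
pose F (a : R) := 2 * sphere_area N / j ^+ 2 *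
  (a `^ (N%:R / 2) * expR (- (j ^+ 2 / (2 * a)) * T)).
have F1 : 2 * sphere_area N / j ^+ 2 * expR (- (1 / 2) * j ^+ 2 * T) = F 1.
  rewrite /F powR1.
  have -> : - (j ^+ 2 / (2 * 1)) * T = - (1 / 2) * j ^+ 2 * T by field.
  by rewrite [1 * expR _]mul1r.
(* the bounds on the balls [sqn x <= threshold k] increase to the claim *)
have cF : F (threshold k) @[k --> \oo] --> F 1.
  apply: cvgM; first exact: cvg_cst.
  have h := @threshold_cvg1 R.
  apply: cvgM.
    have hp : {for 1, continuous (fun a : R => a `^ (N%:R / 2))}.
      exact: is_derive_cvg (is_derive1_powR _ ltr01).
    exact: (cvg_comp _ _ h hp).
  apply: continuous_cvg; first exact: continuous_expR.
  apply: cvgM; last exact: cvg_cst.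
  apply: cvgN; apply: cvgM; first exact: cvg_cst.
  apply: cvgV; first by rewrite mulr1 gt_eqF.
  by apply: cvgM => //; exact: cvg_cst.
have cFE : (F (threshold k))%:E @[k --> \oo] --> (F 1)%:E.
  by apply: cvg_EFin => //; exact: nearW.
rewrite F1 -(cvg_lim _ cFE)//; apply: lime_le.
  by apply/cvg_ex; exists (F 1)%:E.
apply: nearW => k.
have mc i := measurable_confined BM T0 (threshold i).
have mprob i := measurable_prob_confined BM (threshold i) T0.
apply: le_trans (confined_lower_bound BM N0 T0 (threshold_gt0 k) (threshold_lt1 k) j_zero) _.
apply: ge0_le_integral.
- exact: measurable_open_unit_ball.
- by move=> x _; exact: measure_ge0.
- exact: measurable_funTS.
- apply: measurable_funTS.
  apply: (emeasurable_fun_cvg (fun i x => P x (confined B T (threshold i)))) => // x _.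
  rewrite (running_max_lt1E BM T0); apply: nondecreasing_cvg_mu => //.
  + by apply: bigcupT_measurable => i.
  + exact: confined_nondecreasing.
- move=> x _; apply: le_measure; rewrite ?inE//.
    exact: (measurable_running_max_lt1 BM T0).
  by rewrite (running_max_lt1E BM T0) => w hw; exists k.
Qed.
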